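(* Assume the information sufficiency, regular value and regular virtual value conditions. Then in the Simulated-Myerson Auction truthfulness (participating, reporting the true type and fully revealing the information variable) forms a Bayes-Nash equilibrium in the ex-post stage, i.e. the auction is ex-post IIC and ex-post IR; and it achieves the optimal revenue, i.e. its expected revenue $\mathbf{E}_{\boldsymbol\sigma\sim\boldsymbol\tau}\mathbf{E}_{\boldsymbol t\sim h}\big[\sum_{i=1}^n p_i(\boldsymbol t;\boldsymbol\sigma)\big]$ is maximal among all ex-post IIC and ex-post IR mechanisms.
   Context: Setting. A single item is auctioned to $n$ bidders. Bidder $i$ has a type set $T_i$, a finite state set $\Theta_i$ and a value function $v_i:T_i\times\Theta_i\to\mathbb{R}$. Write $T=\prod_i T_i$, $\Theta=\prod_i\Theta_i$, and $\Delta(X)$ for the probability distributions on $X$. The state profile $\boldsymbol\theta$ is drawn from a prior $g\in\Delta(\Theta)$ with marginals $g_i$ (states may be correlated). Types $t_i\sim h_i$ are independent across bidders and independent of states and signals. An experiment of bidder $i$ is $\tau_i\in\Delta(\Delta(\Theta_i))$ with mean $g_i$; its outcome $\sigma_i\in\Delta(\Theta_i)$ is the posterior belief on $\theta_i$, i.e. $\Pr(\theta_i\mid\sigma_i)=\sigma_i(\theta_i)$. Write $\tau_i\geq_{\mathrm{MPS}}\lambda_i$ if $\sigma_i\sim\tau_i$ and $s_i\sim\lambda_i$ can be coupled so that $\mathbf{E}[\sigma_i\mid s_i]=s_i$. Bidder $i$ privately observes $t_i$ and $\sigma_i\sim\tau_i$ (not $\theta_i$). Standing assumption: $\theta_i\perp\sigma_j\mid\sigma_i$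 for all $i\neq j$, so that once $\sigma_i$ is known the other bidders' signals do not change the belief about $\theta_i$. Bidder $i$ acts by reporting $b_i\in T_i$ and committing to an experiment $\lambda_i$ with $\tau_i\geq_{\mathrm{MPS}}\lambda_i$ ($\lambda_i=\tau_i$ is full revelation); the auctioneer sees $\boldsymbol b$ and $\boldsymbol s=(s_1,\dots,s_n)$, $s_i\sim\lambda_i$. Inference. Given $\boldsymbol\theta$, signals are independent across bidders, so $\boldsymbol s$ has joint distribution $\boldsymbol\lambda(\boldsymbol s)=\sum_{\boldsymbol\theta}g(\boldsymbol\theta)\prod_i s_i(\theta_i)\lambda_i(s_i)/g_i(\theta_i)$ and the posterior is $\Pr(\boldsymbol\theta\mid\boldsymbol s)\propto g(\boldsymbol\theta)\prod_i s_i(\theta_i)/g_i(\theta_i)$; $\boldsymbol s$ is identified with this posterior in $\Delta(\Theta)$. Let $v_i(b_i;\boldsymbol s)=\sum_{\boldsymbol\theta}\Pr(\boldsymbol\theta\mid\boldsymbol s)v_i(b_i;\theta_i)$. If bidder $i$ fully reveals $\sigma_i$ then $v_i(b_i;\sigma_i,s_{-i})=v_i(b_i;\sigma_i):=\sum_{\theta_i}\sigma_i(\theta_i)v_i(b_i;\theta_i)$. $\boldsymbol\tau$ denotes the joint distribution of $\boldsymbol\sigma$ under full revelation. Mechanisms. A mechanism is $(x,p)$ with $x,p:T\times\Delta(\Theta)\to\mathbb{R}^n_{+}$, $\sum_i x_i\le1$. With true type $t_i$, $\mathtt U_i(\boldsymbol b;\boldsymbol s)=x_i(\boldsymbol b;\boldsymbol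 s)v_i(t_i;\boldsymbol s)-p_i(\boldsymbol b;\boldsymbol s)$ and $\bar{\mathtt U}_i(\boldsymbol b;\boldsymbol\lambda)=\mathbf{E}_{\boldsymbol s\sim\boldsymbol\lambda}[\mathtt U_i(\boldsymbol b;\boldsymbol s)]$. Ex-post IIC: $\bar{\mathtt U}_i(t_i,t_{-i};\tau_i,\tau_{-i})\ge\bar{\mathtt U}_i(b_i,t_{-i};\lambda_i,\tau_{-i})$ for every $i$, all $t_i,b_i\in T_i$, $t_{-i}\in T_{-i}$ and every $\lambda_i$ with $\tau_i\geq_{\mathrm{MPS}}\lambda_i$. Ex-post IR: $\mathtt U_i(t_i,t_{-i};\sigma_i,\sigma_{-i})\ge0$ for every $i$, every truthful type profile and every fully revealing signal profile. Virtual values. For each $\theta_i$, let $F_i^{\theta}$ be the distribution function of the value $v_i(t_i;\theta_i)$, $t_i\sim h_i$, with density $f_i^{\theta}$. The state-dependent virtual value of type $t_i$ is $\phi_i(t_i;\theta_i)=v_i(t_i;\theta_i)-\frac{1-F_i^{\theta}(v_i(t_i;\theta_i))}{f_i^{\theta}(v_i(t_i;\theta_i))}$, and $\phi_i^{-1}(\cdot;\theta_i)$ is its inverse in $t_i$. Simulated-Myerson Auction. For each $\boldsymbol\theta$, let $x_i(\boldsymbol b;\boldsymbol\theta)=1$ if $\phi_i(b_i;\theta_i)>0$ and $i=\arg\max_j\phi_j(b_j;\theta_j)$ (fixed tie-breaking), else $0$; let $p_i(\boldsymbol b;\boldsymbol\theta)=v_i(b_i^*;\theta_i)$ with $b_i^*=\phi_i^{-1}\big(\max\{0,\max_{j\ne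 i}\phi_j(b_j;\theta_j)\};\theta_i\big)$ if $x_i(\boldsymbol b;\boldsymbol\theta)=1$, else $0$. The auction outputs $x_i(\boldsymbol b;\boldsymbol s)=\sum_{\boldsymbol\theta}\Pr(\boldsymbol\theta\mid\boldsymbol s)x_i(\boldsymbol b;\boldsymbol\theta)$ and $p_i(\boldsymbol b;\boldsymbol s)=\sum_{\boldsymbol\theta}\Pr(\boldsymbol\theta\mid\boldsymbol s)p_i(\boldsymbol b;\boldsymbol\theta)$. Conditions. Information sufficiency: for every $i$, every type $t_i$, every outcome $\sigma_i$ of $\tau_i$ and every fixed $(t_{-i},\theta_{-i})$, $\mathbf{Var}_{\theta_i\sim\sigma_i}[x_i(\boldsymbol t;\theta_i,\theta_{-i})]=0$. Regular values: for every $i$ and $\theta_i,\theta_i'\in\Theta_i$, $v_i(t_i;\theta_i)\ge v_i(t_i;\theta_i')\iff v_i(t_i';\theta_i)\ge v_i(t_i';\theta_i')$ for all $t_i,t_i'\in T_i$. Regular virtual value: for every $i$, $v_i(t_i;\theta_i)\ge v_i(t_i';\theta_i')\iff\phi_i(t_i;\theta_i)\ge\phi_i(t_i';\theta_i')$ for all $t_i,t_i'\in T_i$, $\theta_i,\theta_i'\in\Theta_i$.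
   Formalization: Added, as optimality fails otherwise: each v_i(.;θ_i) has finite mean, its values form an interval with positive density, and all states order a bidder's types alike. Where φ_i^{-1} is undefined, the infimum of values with larger virtual value is used. Mechanisms are measurable. *)

(* Defs.v *)
From HB Require Import structures.
From mathcomp Require Import all_boot all_order all_algebra all_fingroup.
From mathcomp Require Import all_classical all_reals all_analysis.

Set Implicit Arguments.
Unset Strict Implicit.
Unset Printing Implicit Defensive.
Import Order.TTheory GRing.Theory Num.Theory.
Import numFieldNormedType.Exports.
Local Open Scope classical_set_scope.
Local Open Scope ring_scope.

(* Finite nonempty sets.  The point only records nonemptiness: every
   measurableType is pointed, and Delta(X) is empty when X is. *)
#[short(type="pfinType")]
HB.structure Definition PointedFinite := {X of Finite X & isPointed X}.

Section product_of_measurable_types.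

Definition profile n (T : 'I_n -> Type) := forall i, T i.

Definition profile_display n : ('I_n -> measure_display) -> measure_display.
Proof. by move=> _; exact: default_measure_display. Qed.

Context n (d : 'I_n -> measure_display) (T : forall i, measurableType (d i)).

Definition profile_cylinders : set (set (profile T)) :=
  \bigcup_i preimage_set_system setT (fun t : profile T => t i) measurable.

HB.instance Definition _ := gen_eqMixin (profile T).
HB.instance Definition _ := gen_choiceMixin (profile T).
HB.instance Definition _ := isPointed.Build (profile T) (fun=> point).
HB.instance Definition _ := @isMeasurable.Build (profile_display d) (profile T)
  <<s profile_cylinders >> (@sigma_algebra0 _ setT profile_cylinders)
  (@sigma_algebraC _ profile_cylinders)
  (@sigma_algebra_bigcup _ setT profile_cylinders).

Lemma measurable_coord i : measurable_fun setT (fun t : profile T => t i).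
Proof.
move=> _ A mA; apply: sub_sigma_algebra; exists i => //.
by exists A.
Qed.

Lemma measurable_profile d' (X : measurableType d') (f : X -> profile T) :
  (forall i, measurable_fun setT (fun x => f x i)) -> measurable_fun setT f.
Proof.
move=> mf; apply: (@measurability _ _ _ _ _ _ profile_cylinders) => //.
move=> _ [_ [i _ [A mA <-]] <-]; rewrite setTI -comp_preimage setTI.
by have := mf i measurableT A mA; rewrite setTI.
Qed.

End product_of_measurable_types.

Section product_of_probabilities.
Context {R : realType}.

Definition pcons n (T : 'I_n.+1 -> Type)
    (z : T ord0 * profile (fun i : 'I_n => T (lift ord0 i))) : profile T :=
  fun i => match unliftP ord0 i with
  | UnliftSome j e => eq_rect_r T (z.2 j) e
  | UnliftNone e => eq_rect_r T z.1 e
  end.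

Section pcons_measurable.
Context n (d : 'I_n.+1 -> measure_display) (T : forall i, measurableType (d i)).

Lemma measurable_pcons : measurable_fun setT (@pcons n T).
Proof.
apply: measurable_profile => i; rewrite /pcons.
case: (unliftP ord0 i) => [j e|e]; subst i; rewrite /eq_rect_r /=.
  exact: (measurableT_comp (@measurable_coord _ _ _ j) measurable_snd).
exact: measurable_fst.
Qed.

HB.instance Definition _ := isMeasurableFun.Build _ _ _ _ (@pcons n T)
  measurable_pcons.

End pcons_measurable.

Fixpoint prod_probability n : forall (d : 'I_n -> measure_display)
    (T : forall i, measurableType (d i)),
    (forall i, probability (T i) R) -> probability (profile T) R :=
  match n with
  | 0 => fun _ _ _ => \d_(point)
  | n'.+1 => fun _ T P => distribution
      (P ord0 \x prod_probability (fun i : 'I_n' => P (lift ord0 i)))%E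
      (@pcons n' T)
  end.

Lemma measurable_box n (d : 'I_n -> measure_display)
    (T : forall i, measurableType (d i)) (A : forall i, set (T i)) :
  (forall i, measurable (A i)) ->
  measurable [set t : profile T | forall i, A i (t i)].
Proof.
move=> mA; rewrite (_ : [set _ | _] =
    \bigcap_(i in [set: 'I_n]) [set t : profile T | A i (t i)]); last first.
  by apply/seteqP; split=> [t At i _|t At i]; exact: At.
apply: fin_bigcap_measurable => [|i _]; first exact: finite_finset.
by rewrite -[X in measurable X]setTI; exact: measurable_coord.
Qed.

Lemma prod_probabilityE n (d : 'I_n -> measure_display)
    (T : forall i, measurableType (d i)) (P : forall i, probability (T i) R)
    (A : forall i, set (T i)) : (forall i, measurable (A i)) ->
  prod_probability P [set t | forall i, A i (t i)] = (\prod_i P i (A i))%E.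
Proof.
elim: n d T P A => [|n IH] d T P A mA.
  by rewrite big_ord0 /= diracE mem_set//= => -[].
rewrite big_ord_recl -IH//= /distribution /pushforward.
rewrite (_ : _ @^-1` _ =
    A ord0 `*` [set t | forall i, A (lift ord0 i) (t i)]); last first.
  apply/seteqP; split=> -[x t] /=.
    move=> H; split.
      have := H ord0; rewrite /pcons; case: (unliftP ord0 ord0) => [j e|e].
        by exfalso; move: (neq_lift ord0 j); rewrite -e eqxx.
      by rewrite (eq_irrelevance e erefl).
    move=> i; have := H (lift ord0 i); rewrite /pcons.
    case: (unliftP ord0 (lift ord0 i)) => [j e|e].
      have ij := lift_inj e; subst j.
      by rewrite (eq_irrelevance e erefl).
    by exfalso; move: (neq_lift ord0 i); rewrite e eqxx.
  move=> [Ax At] i; rewrite /pcons.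
  by case: (unliftP ord0 i) => [j e|e]; subst i; rewrite /eq_rect_r /=.
rewrite product_measure1E//.
exact: (@measurable_box _ _ _ (fun i : 'I_n => A (lift ord0 i))).
Qed.

End product_of_probabilities.

Section distributions_on_finite_sets.
Context {R : realType}.

Definition is_dist (X : finType) (p : {ffun X -> R}) :=
  [forall x, 0 <= p x] && (\sum_x p x == 1).

Record dist (X : finType) := Dist {
  dist_val :> {ffun X -> R} ;
  _ : is_dist dist_val }.

HB.instance Definition _ (X : finType) := [isSub for @dist_val X].
HB.instance Definition _ (X : finType) := [Choice of dist X by <:].

Context (X : pfinType).

Lemma is_dist_point : is_dist [ffun x : X => (x == point)%:R : R].
Proof.
apply/andP; split; first by apply/forallP => x; rewrite ffunE ler0n.
rewrite (bigD1 point)//= ffunE eqxx big1 ?addr0// => x /negbTE xp.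
by rewrite ffunE xp.
Qed.

HB.instance Definition _ := isPointed.Build (dist X) (Dist is_dist_point).

(* Generates the Borel sets of the simplex. *)
Definition dist_cylinders : set (set (dist X)) :=
  \bigcup_x preimage_set_system setT (fun s : dist X => s x) measurable.

HB.instance Definition _ := @isMeasurable.Build (sigma_display dist_cylinders)
  (dist X) <<s dist_cylinders >> (@sigma_algebra0 _ setT dist_cylinders)
  (@sigma_algebraC _ dist_cylinders)
  (@sigma_algebra_bigcup _ setT dist_cylinders).

Definition dist_variance (s : dist X) (F : X -> R) : R :=
  \sum_x s x * (F x - \sum_y s y * F y) ^+ 2.

(* The outcomes of an experiment: the topological support of its law, i.e. the
   posteriors of positive probability when the law is discrete. *)
Definition outcome (tau : probability (dist X) R) (s : dist X) :=
  forall e : R, 0 < e -> (0 < tau [set s' : dist X | forall x, (`|s' x - s x| < e)%R])%E.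

(* gamma is the law of the coupling (sigma, s); the last clause is
   E[sigma | s] = s. *)
Definition MPS (tau lam : probability (dist X) R) :=
  exists gamma : probability (dist X * dist X)%type R, [/\
    forall A, measurable A -> gamma (fst @^-1` A) = tau A,
    forall A, measurable A -> gamma (snd @^-1` A) = lam A &
    forall A, measurable A -> forall x,
      (\int[gamma]_(z in snd @^-1` A) (z.1 x)%:E
       = \int[gamma]_(z in snd @^-1` A) (z.2 x)%:E)%E].

End distributions_on_finite_sets.
Arguments dist R X : clear implicits.

Definition state_profile n (Theta : 'I_n -> finType) :=
  {dffun forall i, Theta i}.

HB.instance Definition _ n (Theta : 'I_n -> finType) :=
  Finite.on (state_profile Theta).
HB.instance Definition _ n (Theta : 'I_n -> pfinType) :=
  isPointed.Build (state_profile Theta) [ffun i => point].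

Definition signal_profile (R : realType) n (Theta : 'I_n -> pfinType) :=
  profile (fun i => dist R (Theta i)).

Section information.
Context {R : realType} {n : nat} {Theta : 'I_n -> pfinType}.
Implicit Types (g : dist R (state_profile Theta))
  (lam tau : forall i, probability (dist R (Theta i)) R).

Definition marginal g i (a : Theta i) : R :=
  \sum_(th : state_profile Theta | th i == a) g th.

Definition is_experiment g i (tau : probability (dist R (Theta i)) R) :=
  forall a, (\int[tau]_s (s a)%:E)%E = (marginal g a)%:E.

(* Density of the joint law of (theta, s) with respect to the counting measure
   times the product of the lambda_i, and of its s-marginal.  A state with
   g_i(theta_i) = 0 contributes 0 since g(theta) = 0. *)
Definition state_signal_density g (th : state_profile Theta)
    (s : signal_profile R Theta) : R :=
  g th * \prod_i (s i (th i) / marginal g (th i)).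

Definition signal_density g (s : signal_profile R Theta) : R :=
  \sum_th state_signal_density g th s.

Definition expect_signals g lam (F : signal_profile R Theta -> \bar R) :=
  (\int[prod_probability lam]_s ((signal_density g s)%:E * F s))%E.

(* Equal to the prior g at the signal profiles where the density vanishes. *)
Definition posterior g (s : signal_profile R Theta) :
    dist R (state_profile Theta) :=
  insubd g [ffun th => state_signal_density g th s / signal_density g s].

Definition revealed g tau (s : signal_profile R Theta) :=
  (forall i, outcome (tau i) (s i)) /\ 0 < signal_density g s.

(* theta_i and sigma_j are independent given sigma_i, for i <> j: the law of
   theta_i given (sigma_i, sigma_j) is its law given sigma_i, which is sigma_i
   itself.  Thus
   Pr(theta_i = a, sigma_i \in A, sigma_j \in B)
     = E[sigma_i(a); sigma_i \in A, sigma_j \in B]. *)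
Definition signals_cond_independent g tau :=
  forall i j, i != j -> forall (a : Theta i)
    (A : set (dist R (Theta i))) (B : set (dist R (Theta j))),
  measurable A -> measurable B ->
  let E := [set s : signal_profile R Theta | A (s i) /\ B (s j)] in
  (\sum_(th : state_profile Theta | th i == a)
     \int[prod_probability tau]_(s in E) (state_signal_density g th s)%:E
   = expect_signals g tau (fun s => (s i a * \1_E s)%:E))%E.

End information.

Section mechanisms.
Context {R : realType} {n : nat} {d : 'I_n -> measure_display}
  {T : forall i, measurableType (d i)} {Theta : 'I_n -> pfinType}.
Variables (v : forall i, Theta i -> {mfun T i >-> R})
  (g : dist R (state_profile Theta))
  (tau : forall i, probability (dist R (Theta i)) R).

Record mechanism := Mechanism {
  alloc : profile T -> dist R (state_profile Theta) -> 'I_n -> R ;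
  pay : profile T -> dist R (state_profile Theta) -> 'I_n -> R }.

Definition is_mechanism (M : mechanism) := [/\
  forall b mu i, 0 <= alloc M b mu i /\ 0 <= pay M b mu i,
  forall b mu, \sum_i alloc M b mu i <= 1,
  forall i, measurable_fun setT
    (fun z : profile T * dist R (state_profile Theta) => alloc M z.1 z.2 i) &
  forall i, measurable_fun setT
    (fun z : profile T * dist R (state_profile Theta) => pay M z.1 z.2 i)].

Definition post_value i (t : T i) (mu : dist R (state_profile Theta)) : R :=
  \sum_(th : state_profile Theta) mu th * v (th i) t.

Definition utility (M : mechanism) i (t : T i) (b : profile T)
    (mu : dist R (state_profile Theta)) : R :=
  alloc M b mu i * post_value t mu - pay M b mu i.

Definition expected_utility (M : mechanism) i (t : T i) (b : profile T)
    (lam : forall j, probability (dist R (Theta j)) R) :=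
  expect_signals g lam (fun s => (utility M t b (posterior g s))%:E).

Definition expost_IIC (M : mechanism) :=
  forall i (t : profile T) (b : T i) (lam : probability (dist R (Theta i)) R),
  MPS (tau i) lam ->
  (expected_utility M (t i) (dfwith t i b) (dfwith tau i lam)
   <= expected_utility M (t i) t tau)%E.

Definition expost_IR (M : mechanism) :=
  forall i (t : profile T) (s : signal_profile R Theta), revealed g tau s ->
  0 <= utility M (t i) t (posterior g s).

Definition revenue (h : forall i, probability (T i) R) (M : mechanism) :=
  expect_signals g tau (fun s =>
    (\int[prod_probability h]_t (\sum_i pay M t (posterior g s) i)%:E)%E).

End mechanisms.
Arguments mechanism R {n d} T Theta.

Section virtual_values.
Context {R : realType} {n : nat} {d : 'I_n -> measure_display}
  {T : forall i, measurableType (d i)} {Theta : 'I_n -> pfinType}.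
Variables (v : forall i, Theta i -> {mfun T i >-> R})
  (h : forall i, probability (T i) R) (f : forall i, Theta i -> R -> R).

Definition value_cdf i (a : Theta i) (y : R) : R :=
  fine (cdf (v a : {RV (h i) >-> R}) y).

Definition is_value_density := forall i (a : Theta i), [/\
  measurable_fun setT (f a), (forall y, 0 <= f a y) &
  forall A : set R, measurable A ->
    (distribution (h i) (v a) A
     = \int[lebesgue_measure]_(y in A) (f a y)%:E)%E].

Definition virtual_value i (t : T i) (a : Theta i) : R :=
  v a t - (1 - value_cdf a (v a t)) / f a (v a t).

(* The conditions under which the virtual value is the marginal revenue, as in
   Myerson's single-parameter model: values are integrable, each v_i(.;theta_i)
   has an interval as range and a positive density there, and a higher type is
   one with a higher value in every state. *)
Definition myerson_setting := [/\
  forall i (a : Theta i), (h i).-integrable setT (EFin \o v a),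
  forall i (a : Theta i), is_interval (range (v a)),
  forall i (a : Theta i) t, 0 < f a (v a t) &
  forall i (a a' : Theta i) t t', (v a t <= v a t') = (v a' t <= v a' t')].

Definition regular_values := forall i (a a' : Theta i) t t',
  (v a t >= v a' t) = (v a t' >= v a' t').

Definition regular_virtual_values := forall i (a a' : Theta i) t t',
  (v a t >= v a' t') = (virtual_value t a >= virtual_value t' a').

End virtual_values.

Section simulated_myerson.
Context {R : realType} {n : nat} {d : 'I_n -> measure_display}
  {T : forall i, measurableType (d i)} {Theta : 'I_n -> pfinType}.
Variables (v : forall i, Theta i -> {mfun T i >-> R})
  (h : forall i, probability (T i) R) (f : forall i, Theta i -> R -> R)
  (prio : {perm 'I_n}).
Local Notation phi := (virtual_value v h f).

(* Ties are broken in favour of the smallest value of prio. *)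
Definition wins (b : profile T) (th : state_profile Theta) i : bool :=
  (0 < phi (b i) (th i)) &&
  [forall j, (j != i) ==>
    ((phi (b j) (th j) < phi (b i) (th i)) ||
     ((phi (b j) (th j) == phi (b i) (th i)) && (prio i < prio j)%N))].

Definition threshold (b : profile T) (th : state_profile Theta) i : R :=
  \big[Num.max/0]_(j | j != i) phi (b j) (th j).

(* The value v_i(phi_i^{-1}(y; theta_i); theta_i).  If y is not attained by
   phi_i(.;theta_i), as when all virtual values exceed it, this is the infimum
   of the values whose virtual value exceeds y. *)
Definition critical_value i (a : Theta i) (y : R) : R :=
  let inverse := [set t : T i | phi t a = y] in
  if `[< inverse !=set0 >] then v a (get inverse)
  else inf [set v a t | t in [set t : T i | y < phi t a]].

Definition myerson_pay (b : profile T) (th : state_profile Theta) i : R :=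
  if wins b th i then critical_value (th i) (threshold b th i) else 0.

Definition SMA : mechanism R T Theta := Mechanism
  (fun b mu i => \sum_th mu th * (wins b th i)%:R)
  (fun b mu i => \sum_th mu th * myerson_pay b th i).

Definition with_state (th : state_profile Theta) i (a : Theta i) :
    state_profile Theta := [ffun j => dfwith th i a j].

Definition information_sufficient
    (tau : forall i, probability (dist R (Theta i)) R) :=
  forall i (t : profile T) (s : dist R (Theta i)), outcome (tau i) s ->
  forall th : state_profile Theta,
  dist_variance s (fun a => (wins t (with_state th a) i)%:R) = 0.

End simulated_myerson.

(* Main.v *)
Require Import Defs.
From HB Require Import structures.
From mathcomp Require Import all_boot all_order all_algebra all_fingroup.
From mathcomp Require Import all_classical all_reals all_analysis.
From mathcomp Require Import measurable_realfun.
From mathcomp Require Import ring lra.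

Set Implicit Arguments.
Unset Strict Implicit.
Unset Printing Implicit Defensive.
Import Order.TTheory GRing.Theory Num.Theory.
Import numFieldNormedType.Exports.
Local Open Scope classical_set_scope.
Local Open Scope ring_scope.

(** Truthfulness.  Each state-wise auction is a Myerson auction, and under
  information sufficiency its winner is the same at every state profile that the
  revealed signals allow, so truth-telling attains the state-wise optimum in
  expectation.  A deviator who garbles receives E[win] E[value] instead of
  E[win value]; states are ordered alike by all types, so both factors increase
  with the own state and Chebyshev's sum inequality makes the former smaller.

  Optimality.  Fix an ex-post IIC mechanism and the types of the opponents.  All
  values of bidder i are increasing functions of one quantile, and incentive
  compatibility makes the allocation, weighted by the states, a subgradient of
  the rent.  Comparing each type with the one e quantiles above it and letting e
  go to 0 (Fatou, Lebesgue differentiation) bounds the expected rent below by the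
  expectation of the allocation times (1 - F) / f.  Hence revenue is at most the
  virtual surplus, which is largest state by state at the Myerson allocation, and
  the threshold payments of the latter recover at least its virtual surplus. *)

(** Types carry no order or topology of their own; the common quantile, uniform by
    [quantile_uniform], replaces them by points of the unit interval. Of the rent only monotonicity
    and the subgradient inequality are used, so the bound of [envelope_ge] is one-sided, in the
    direction that optimality needs. The payments are treated by an inequality as well: a threshold
    below all virtual values is not attained, and the critical value is then an infimum.

    Integrability of payments is never invoked. Nonnegative integrals are compared by Tonelli after
    the rent is added to both sides, and only the rent, finite because values are integrable, is
    cancelled.

    Information sufficiency speaks of outcomes of [tau i], whereas the signal of a deviator may be
    no such outcome. Monotonicity of the winning status is therefore checked at a profile where the
    deviator's signal is exchanged for an outcome that supports the own state in question. *)

Section lebesgue_shift.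
Context {R : realType}.
Local Notation mu := (@lebesgue_measure R).

Lemma lebesgue_measure_shift (c : R) (A : set R) : measurable A ->
  pushforward mu (fun x => (x + c : measurableTypeR R)) A = mu A.
Proof.
move=> mA.
have mc : measurable_fun setT (fun x : R => (x + c : measurableTypeR R)).
  exact: measurable_funD.
pose m := [the measure _ _ of pushforward mu
  (fun x : R => (x + c : measurableTypeR R))].
apply/esym/(lebesgue_measure_unique (mu := m mc)) => //= _ [[a b]] _ <- /=.
rewrite /pushforward (_ : _ @^-1` _ = `](a - c), (b - c)]%classic); last first.
  by apply/seteqP; split=> x /=; rewrite !in_itv/= ltrBlDr lerBrDr.
rewrite !lebesgue_measure_itv/= !lte_fin ltrD2r; case: ifP => // _.
by rewrite -!EFinD; congr EFin; lra.
Qed.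

Lemma ge0_integral_shift (c : R) (D : set R) (G : R -> \bar R) :
  measurable D -> measurable_fun D G -> (forall x, D x -> 0 <= G x)%E ->
  (\int[mu]_(x in [set x | D (x + c)%R]) G (x + c)%R = \int[mu]_(x in D) G x)%E.
Proof.
move=> mD mG G0.
have mc : measurable_fun setT
  ((fun x : R => x + c) : measurableTypeR R -> measurableTypeR R).
  exact: measurable_funD.
have := @ge0_integral_pushforward _ _ _ _ _ _ mc mu D G mD mG.
rewrite /comp/= => <-; last by move=> x /set_mem/G0.
by apply: eq_measure_integral => A mA _; exact: lebesgue_measure_shift.
Qed.

End lebesgue_shift.

(** * Virtual values of a random variable with a density *)

Section absolutely_continuous_variable.
Context {R : realType} {d} {T : measurableType d} (P : probability T R)
  (X : {RV P >-> R}) (f : R -> R).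
Hypotheses (mf : measurable_fun setT f) (f0 : forall y, 0 <= f y).
Hypothesis XE : forall A : set R, measurable A ->
  distribution P X A = (\int[lebesgue_measure]_(y in A) (f y)%:E)%E.
Local Notation mu := (@lebesgue_measure R).

(** Convertible with [value_cdf], so that [virtual_valueE] holds by computation. *)
Definition cdfR (y : R) : R := fine (cdf X y).

Lemma cdfRE y : P [set t | X t <= y] = (cdfR y)%:E.
Proof. by rewrite fineK ?fin_num_measure. Qed.

Lemma cdfR_ge0 y : 0 <= cdfR y.
Proof. by rewrite -lee_fin -cdfRE. Qed.

Lemma cdfR_le1 y : cdfR y <= 1.
Proof. by rewrite -lee_fin fineK ?fin_num_measure// cdf_le1. Qed.

Lemma cdfR_nd : {homo cdfR : x y / x <= y}.
Proof.
by move=> x y xy; rewrite fine_le ?fin_num_measure// cdf_nondecreasing.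
Qed.

Lemma measurable_cdfR : measurable_fun setT cdfR.
Proof. exact: nondecreasing_measurable cdfR_nd. Qed.

Lemma integrable_density : mu.-integrable setT (EFin \o f).
Proof.
apply/integrableP; split; first exact/measurable_EFinP.
under eq_integral do rewrite /= ger0_norm//.
by rewrite -XE//= probability_setT ltry.
Qed.

Lemma cdfR_int y : cdfR y = (\int[mu]_(z in `]-oo, y]) f z)%R.
Proof. by rewrite /cdfR /cdf XE. Qed.

Lemma negligible_rv N : mu.-negligible N -> P.-negligible (X @^-1` N).
Proof.
move=> [A [mA A0 NA]]; exists (X @^-1` A); split; first exact: measurable_funPTI.
  rewrite -[LHS]/(distribution P X A) XE// null_set_integral//.
  exact/measurable_funTS/measurable_EFinP.
by move=> t /NA.
Qed.

Lemma ae_rv (Q : R -> Prop) : {ae mu, forall y, Q y} -> {ae P, forall t, Q (X t)}.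
Proof. exact: negligible_rv. Qed.

Lemma rv_eq0 y : P [set t | X t = y] = 0%E.
Proof.
suff : P.-negligible [set t | X t = y].
  by apply: measure_negligible; exact: (@measurable_funPTI _ _ _ _ X [set y]).
apply: (@negligible_rv [set y]).
by apply/negligibleP => //; exact: lebesgue_measure_set1.
Qed.

Lemma cdfR_itv x y : x <= y ->
  (cdfR y - cdfR x)%:E = (\int[mu]_(z in `]x, y]) (f z)%:E)%E.
Proof.
move=> xy; rewrite -XE// EFinB -!cdfRE.
have mle z : measurable [set t | X t <= z].
  by rewrite (_ : mkset _ = X @^-1` `]-oo, z]) //; exact: measurable_funPTI.
rewrite [X in (_ - P X)%E](_ : _ = [set t | X t <= y] `&` [set t | X t <= x]).
  rewrite -measureD//; last by rewrite (le_lt_trans (probability_le1 _ _))// ltry.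
  congr (P _); apply/seteqP; split=> t /=; rewrite in_itv/=.
    by move=> [-> /negP]; rewrite -ltNge => ->.
  by move=> /andP[xt ty]; split=> //; apply/negP; rewrite -ltNge.
by apply/seteqP; split=> t /=; [move=> tx; split=> //; exact: le_trans xy|move=> []].
Qed.

(** The limits at both infinities bracket [q]. Between the brackets the distribution function is an
    indefinite integral of the density, hence continuous, and the intermediate value theorem
    applies. *)
Lemma cdfR_surj q : 0 < q < 1 -> exists y, cdfR y = q.
Proof.
move=> /andP[q0 q1].
have [b qb] : exists b, q < cdfR b.
  have /fine_cvgP[_ h] := cvg_cdfy1 X.
  have /filter_ex[b qb] : \forall t \near +oo, q < cdfR t by exact: (cvgr_gt _ h q q1).
  by exists b.
have [a aq] : exists a, cdfR a < q.
  have /fine_cvgP[_ h] := cvg_cdfNy0 X.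
  have /filter_ex[a aq] : \forall t \near -oo, cdfR t < q by exact: (cvgr_lt _ h q q0).
  by exists a.
have ab : a <= b.
  rewrite leNgt; apply/negP => /ltW/cdfR_nd ba.
  by have := le_lt_trans ba (lt_trans aq qb); rewrite ltxx.
have fab : mu.-integrable `[a, b] (EFin \o f).
  exact: (integrableS measurableT _ _ integrable_density).
(* [F] agrees with [cdfR] only to the right of [a], which is where continuity is needed. *)
pose F y := cdfR a + parameterized_integral mu a y f.
have FE y : a <= y -> F y = cdfR y.
  move=> ay; apply/eqP; rewrite /F eq_sym addrC -subr_eq; apply/eqP/EFin_inj.
  rewrite cdfR_itv// /parameterized_integral /Rintegral fineK.
    by rewrite integral_itv_obnd_cbnd//; apply/measurable_EFinP; exact: measurable_funTS.
  by apply: integrable_fin_num => //; exact: (integrableS measurableT _ _ integrable_density).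
have [||y] := @IVT _ F a b q ab.
- move=> x; apply: cvgD; first exact: cvg_cst.
  exact: (parameterized_integral_continuous ab fab).
- by rewrite !FE// ge_min le_max (ltW aq) (ltW qb) orbT.
by rewrite in_itv/= => /andP[ay _]; rewrite FE// => <-; exists y.
Qed.

(** A level strictly between 0 and 1 has mass on both sides, so there are values on both sides of
    it; the range being an interval, the level itself is a value. *)
Lemma cdfR_attained q : is_interval (range X) -> 0 < q < 1 ->
  exists t, cdfR (X t) = q.
Proof.
move=> Xitv q01; have [y yq] := cdfR_surj q01.
have [/andP[q0 q1]] := q01.
have [t ty] : exists t, X t <= y.
  apply/not_existsP => Xy; have := q0; rewrite -yq -lte_fin -cdfRE.
  rewrite (_ : mkset _ = set0) ?measure0 ?ltxx//.
  by apply/seteqP; split=> t//= /Xy.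
have [t' yt'] : exists t, y <= X t.
  apply/not_existsP => Xy; have := q1; rewrite -yq -lte_fin -cdfRE.
  rewrite (_ : mkset _ = setT) ?probability_setT ?ltxx//.
  apply/seteqP; split=> t1//= _; have /negP := Xy t1; rewrite -ltNge; exact: ltW.
have [t1 _ t1y] : range X y.
  by apply: (Xitv (X t) (X t')); [exists t|exists t'|exact/andP].
by exists t1; rewrite t1y.
Qed.

(** If the distribution function were flat between two values, the density would vanish almost
    everywhere between them; but every point between two values is a value and has positive
    density. *)
Lemma cdfR_lt : is_interval (range X) -> (forall t, 0 < f (X t)) ->
  forall t t', X t < X t' -> cdfR (X t) < cdfR (X t').
Proof.
move=> Xitv fX t t' tt'; rewrite lt_neqAle cdfR_nd ?(ltW tt')// andbT.
apply/eqP => E.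
have : (\int[mu]_(z in `]X t, X t']) (f z)%:E = 0)%E.
  by rewrite -cdfR_itv ?(ltW tt')// E subrr.
have mitv : measurable (`]X t, X t'] : set R) by exact: measurable_itv.
rewrite (eq_integral (fun z : measurableTypeR R => `|(f z)%:E|)%E); last first.
  by move=> z _; rewrite gee0_abs ?lee_fin.
move/(ae_eq_integral_abs mu mitv) => H.
have {}H := H (measurable_funTS ((measurable_EFinP _ _).2 mf)).
have : mu `]X t, X t'] = 0%E.
  apply/eqP; rewrite eq_le measure_ge0 andbT.
  case: H => N [mN N0 HN]; rewrite -N0; apply: le_measure; rewrite ?inE//.
  move=> z zt; apply: HN => /= /(_ zt) [] fz0.
  have [t1 _ t1z] : range X z.
    move: zt; rewrite /= in_itv/= => /andP[/ltW tz zt].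
    by apply: (Xitv (X t) (X t')); [exists t|exists t'|exact/andP].
  by have := fX t1; rewrite t1z fz0 ltxx.
rewrite lebesgue_measure_itv/= lte_fin tt' -EFinD => -[] /eqP.
by rewrite subr_eq0 => /eqP tE; move: tt'; rewrite tE ltxx.
Qed.

Lemma cdfR_derivable y : lebesgue_pt f y ->
  derivable cdfR y 1 /\ derive1 cdfR y = f y.
Proof.
move=> fy; rewrite (_ : cdfR = fun y => \int[mu]_(z in `]-oo, y]) f z)%R; last first.
  by apply/funext => z; exact: cdfR_int.
(* The point [y + 1] only serves as some endpoint beyond [y]. *)
apply: (@FTC1_lebesgue_pt _ f (BInfty R true) y (y + 1)) => //.
- by rewrite ltrDl.
- exact: (integrableS measurableT _ _ integrable_density).
- by rewrite ltNyr.
Qed.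

Lemma ae_lebesgue_pt_rv : {ae P, forall t, lebesgue_pt f (X t)}.
Proof.
apply: (ae_rv (Q := lebesgue_pt f)); apply: lebesgue_differentiation.
by apply: open_integrable_locally; [exact: openT|exact: integrable_density].
Qed.

End absolutely_continuous_variable.

(** * Measurability of monotone functions and of the inverse *)

Section monotone_on_interval.
Context {R : realType}.

(** Superlevel sets within [D] are intervals. Monotonicity is asked on [D] alone because
    [critical_value] and functions read through [type_of_quantile] are controlled only on an
    interval. *)
Lemma nondecreasing_in_measurable (D : set R) (k : R -> R) :
  is_interval D -> (forall x y, D x -> D y -> x <= y -> k x <= k y) ->
  measurable_fun D k.
Proof.
move=> iD ndk; apply: (measurability (@RGenCInfty.G R)) => [|/= _ [_] [r] -> <-].
  exact: RGenCInfty.measurableE.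
apply: is_interval_measurable => s t /= [Ds ks] [Dt kt] u /andP[su ut].
have Du : D u by apply: iD Ds Dt _ _; apply/andP.
split => //; move: ks; rewrite /= !in_itv/= !andbT => /le_trans; apply.
exact: ndk.
Qed.

Lemma measurable_inv : measurable_fun setT (fun x : R => x^-1).
Proof.
rewrite -(setvU [set 0 : R]).
apply/measurable_funU; [exact: measurableC|exact: measurable_set1|split].
  apply: open_continuous_measurable_fun.
    by rewrite openC; exact: closed_eq.
  by move=> x /set_mem/= /eqP x0; exact: inv_continuous.
exact: measurable_fun_set1.
Qed.

End monotone_on_interval.

(** * Virtual values against the revenue of a posted price *)

Section layer_cake.
Context {R : realType} {d} {T : measurableType d} (P : probability T R)
  (X : {RV P >-> R}) (f : R -> R).
Hypotheses (mf : measurable_fun setT f) (f0 : forall y, 0 <= f y).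
Hypothesis XE : forall A : set R, measurable A ->
  distribution P X A = (\int[lebesgue_measure]_(y in A) (f y)%:E)%E.
Local Notation mu := (@lebesgue_measure R).
Local Notation F := (cdfR X).

(** The Radon-Nikodym derivative of the law of [X] and [f] have the same integral over every
    measurable set, hence coincide almost everywhere. *)
Lemma ge0_integral_density (G : R -> \bar R) : measurable_fun setT G ->
  (forall y, 0 <= G y)%E ->
  (\int[P]_t G (X t) = \int[mu]_y (G y * (f y)%:E))%E.
Proof.
move=> mG G0.
have mX : measurable_fun setT (X : T -> measurableTypeR R).
  have mX' : measurable_fun setT (X : T -> R) by exact: measurable_funPT.
  exact: mX'.
pose X' := @mfun_Sub _ _ T (measurableTypeR R) X (mem_set mX).
pose nu := distribution P X'.
have -> : (\int[P]_t G (X t) = \int[nu]_y G y)%E.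
  by rewrite /nu (ge0_integral_distribution X').
have domX : nu `<< mu.
  apply/null_content_dominatesP => A mA A0; rewrite -[LHS]/(distribution P X A) XE//.
  apply: null_set_integral => //.
  by apply: measurable_funTS; exact/measurable_EFinP.
rewrite -(Radon_Nikodym_SigmaFinite.change_of_variables domX)//.
have mRN := measurable_int _ (Radon_Nikodym_SigmaFinite.f_integrable domX).
apply: ge0_ae_eq_integral => //.
- exact: emeasurable_funM.
- by apply: emeasurable_funM => //; exact/measurable_EFinP.
- by move=> y _; rewrite mule_ge0// Radon_Nikodym_SigmaFinite.f_ge0.
- by move=> y _; rewrite mule_ge0// lee_fin.
have : ae_eq mu setT (Radon_Nikodym_SigmaFinite.f nu mu) (EFin \o f).
  apply: integral_ae_eq => //.
  - exact: Radon_Nikodym_SigmaFinite.f_integrable.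
  - exact/measurable_EFinP.
  - by move=> E _ mE; rewrite -Radon_Nikodym_SigmaFinite.f_integral//; exact: XE.
by apply: filterS => y /= /(_ I) E _; rewrite E.
Qed.

(** Tonelli on the region [r < z < X t]: its slices at fixed [t] have length [X t - r], those at
    fixed [z] have probability [1 - F z]. *)
Lemma ge0_integral_layer_cake r :
  (\int[P]_(t in [set t | (r < X t)%R]) (X t - r)%:E
   = \int[mu]_(z in `]r, +oo[) (1 - F z)%:E)%E.
Proof.
have mr z : measurable [set t | z < X t].
  rewrite (_ : mkset _ = X @^-1` `]z, +oo[).
    exact: (@measurable_funPTI _ _ _ _ X).
  by apply/seteqP; split=> t; rewrite /= in_itv/= andbT.
pose B : set (T * measurableTypeR R) := [set p | r < p.2 /\ p.2 < X p.1].
have mB : measurable B.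
  rewrite (_ : B = (fun p => (r < p.2) && (p.2 < X p.1)) @^-1` [set true]).
    rewrite -[X in measurable X]setTI; apply: measurable_and => //.
      exact: measurable_fun_ltr.
    by apply: measurable_fun_ltr => //; exact: measurableT_comp.
  by apply/seteqP; split=> p /= => [[-> ->]//|/andP[]].
transitivity (\int[P]_t \int[mu]_z (\1_B (t, z))%:E)%E.
  rewrite integral_mkcond; apply: eq_integral => t _.
  rewrite (eq_integral (fun z : measurableTypeR R => (\1_(`]r, X t[) z)%:E)); last first.
    move=> z _; rewrite !indicE; congr ((nat_of_bool _)%:R%:E); apply/idP/idP.
      by move=> /set_mem[/= rz zX]; apply/mem_set; rewrite /= in_itv/= rz.
    by move=> /set_mem/=; rewrite in_itv/= => /andP[rz zX]; apply/mem_set.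
  rewrite [RHS](_ : _ = mu `]r, X t[); last by rewrite integral_indic// setIT.
  rewrite lebesgue_measure_itv/= lte_fin patchE.
  case: ifPn => [/set_mem/= ->//|rt]; case: ifPn => // rt'.
  by exfalso; apply/negP: rt; rewrite negbK; apply/mem_set.
rewrite (@fubini_tonelli _ _ _ _ _ P mu (fun p => (\1_B p)%:E))//; last first.
  by apply/measurable_EFinP; exact: measurable_indic.
rewrite [RHS]integral_mkcond; apply: eq_integral => z _.
rewrite patchE; case: ifPn => [/set_mem/=|rz]; rewrite ?in_itv/= ?andbT.
  move=> rz; rewrite (eq_integral (EFin \o \1_[set t | z < X t])); last first.
    by move=> t _; rewrite /= !indicE; congr ((nat_of_bool _)%:R%:E); apply/idP/idP => /set_mem/= H;
      apply/mem_set => //=; case: H.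
  rewrite integral_indic// setIT EFinB -cdfRE -probability_setC//.
    by congr (P _); apply/seteqP; split=> t /=; rewrite ltNge => /negP.
  rewrite (_ : mkset _ = ~` [set t | z < X t]); first exact: measurableC.
  by apply/seteqP; split=> t /=; rewrite leNgt => /negP.
rewrite integral0_eq// => t _; rewrite indicE memNset//= => -[rz' _].
by move/negP: rz; apply; apply/mem_set; rewrite /= in_itv/= andbT.
Qed.

(** The inverse hazard rate, that is, the gap between a value and its virtual value. *)
Definition hazard_inv t : R := (1 - F (X t)) / f (X t).

Lemma hazard_inv_ge0 t : 0 <= hazard_inv t.
Proof. by rewrite divr_ge0// subr_ge0 cdfR_le1. Qed.

Lemma measurable_hazard_inv : measurable_fun setT hazard_inv.
Proof.
apply: measurable_funM.
  apply: measurable_funB => //; apply: measurableT_comp => //.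
  exact: measurable_cdfR.
apply: (measurableT_comp measurable_inv).
exact: measurableT_comp.
Qed.

Hypothesis X_itv : is_interval (range X).
Hypothesis fX : forall t, 0 < f (X t).

(** Through the density the right side becomes the integral of [(1 - F z) / f z * f z] over [z > r],
    whose integrand is [1 - F z] wherever [f z > 0]. Elsewhere [z] is not a value; some value lies
    below it by the hypothesis on [r], so none lies above it, the range being an interval, and
    [1 - F z] vanishes. *)
Lemma integral_hazard_inv_ge r : (forall z, r < z -> exists t, X t <= z) ->
  (\int[P]_(t in [set t | (r < X t)%R]) (X t - r)%:E
   <= \int[P]_(t in [set t | (r < X t)%R]) (hazard_inv t)%:E)%E.
Proof.
move=> rX; rewrite ge0_integral_layer_cake.
rewrite [leRHS]integral_mkcond.
pose G y : \bar R := ((fun y => ((1 - F y) / f y)%:E) \_ `]r, +oo[) y.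
have mG : measurable_fun setT G.
  apply/(measurable_restrictT _ _).1 => //; apply: measurable_funTS.
  apply/measurable_EFinP; apply: measurable_funM.
    by apply: measurable_funB => //; exact: measurable_cdfR.
  exact: (measurableT_comp measurable_inv).
rewrite (_ : (\int[P]_t _ = \int[P]_t G (X t))%E); last first.
  apply: eq_integral => t _; rewrite /G !patchE /hazard_inv.
  rewrite (_ : (X t \in _) = (t \in [set t | r < X t]))//.
  by apply/idP/idP => /set_mem; rewrite /= ?in_itv/= ?andbT => rt;
    apply/mem_set; rewrite /= ?in_itv/= ?andbT.
rewrite ge0_integral_density; last 2 first.
- exact: mG.
- move=> y; rewrite /G patchE; case: ifPn => // _.
  by rewrite lee_fin divr_ge0// subr_ge0 cdfR_le1.
rewrite integral_mkcond; apply: ge0_le_integral => //.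
- move=> y _; rewrite patchE; case: ifPn => // _.
  by rewrite lee_fin subr_ge0 cdfR_le1.
- apply/(measurable_restrictT _ _).1 => //; apply: measurable_funTS.
  by apply/measurable_EFinP; apply: measurable_funB => //; exact: measurable_cdfR.
- by apply: emeasurable_funM; [exact: mG|exact/measurable_EFinP].
move=> z _; rewrite /G !patchE; case: ifPn => [/set_mem|]; last by rewrite mul0e.
rewrite /= in_itv/= andbT => rz; rewrite -EFinM lee_fin.
have [fz|fz] := ltP 0 (f z); first by rewrite divfK// gt_eqF.
suff -> : F z = 1 by rewrite subrr !mul0r.
have [t tz] := rX _ rz.
apply: EFin_inj; rewrite -cdfRE -[RHS](@probability_setT _ _ _ P); congr (P _).
apply/seteqP; split=> // t1 _ /=; rewrite leNgt; apply/negP => zt1.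
have [t2 _ t2z] : range X z.
  by apply: (X_itv (x := X t) (y := X t1)); [exists t|exists t1|rewrite tz ltW].
by have := fX t2; rewrite t2z ltNge fz.
Qed.

(** The right side is the revenue of a posted price [r], the left side the virtual surplus of the
    types that buy. With [X = (X - r) + r] the claim reduces to [integral_hazard_inv_ge]. *)
Lemma integral_virtual_le r : 0 <= r -> P.-integrable setT (EFin \o X) ->
  (forall z, r < z -> exists t, X t <= z) ->
  (forall t, r < X t -> 0 <= X t - hazard_inv t) ->
  (\int[P]_(t in [set t | (r < X t)%R]) (X t - hazard_inv t)%:E
   <= r%:E * P [set t | (r < X t)%R])%E.
Proof.
move=> r0 iX rX phi0.
have mr : measurable [set t | r < X t].
  rewrite (_ : mkset _ = X @^-1` `]r, +oo[).
    exact: (@measurable_funPTI _ _ _ _ X).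
  by apply/seteqP; split=> t; rewrite /= in_itv/= andbT.
set B := [set t | r < X t] in mr *.
have iXB : P.-integrable B (EFin \o X) by exact: integrableS iX.
have mh : measurable_fun B (EFin \o hazard_inv).
  by apply: measurable_funTS; apply/measurable_EFinP; exact: measurable_hazard_inv.
(* Nonnegative virtual values bound [hazard_inv] by the integrable [X], so the integral of the
   difference may be split. *)
have ih : P.-integrable B (EFin \o hazard_inv).
  apply: le_integrable iXB => // t Bt /=.
  rewrite lee_fin ger0_norm ?hazard_inv_ge0//.
  by rewrite (le_trans _ (ler_norm _))// -subr_ge0 phi0.
under eq_integral do rewrite EFinB.
rewrite integralB//; rewrite leeBlDr; last exact: integrable_fin_num.
rewrite -(integral_cst _ mr) addeC.
have -> : (\int[P]_(t in B) (X t)%:E =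
  \int[P]_(t in B) (X t - r)%:E + \int[P]_(t in B) r%:E)%E.
  rewrite -ge0_integralD//.
  - by apply: eq_integral => t _; rewrite -EFinD subrK.
  - by move=> t; rewrite lee_fin subr_ge0 => /ltW.
  - by apply/measurable_EFinP; apply: measurable_funB => //; exact: measurable_funTS.
by rewrite leeD2r//; exact: integral_hazard_inv_ge.
Qed.

End layer_cake.

(** * Quantiles and the rent inequality *)

Section clamp.
Context {R : realType}.
(** The distribution function of the uniform law on the unit interval. *)
Local Notation c q := (Num.max 0 (Num.min 1 q) : R).

Let cE (q : R) : [\/ q <= 0 /\ c q = 0, 0 < q < 1 /\ c q = q | 1 <= q /\ c q = 1].
Proof.
have [q0|q0] := leP q 0; first by constructor 1; rewrite min_r ?max_l//; lra.
have [q1|q1] := leP 1 q; first by constructor 3; rewrite max_r.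
by constructor 2; rewrite max_r// ltW.
Qed.

Lemma clamp_le (a b : R) : a <= b -> c a <= c b.
Proof. by case: (cE a) => -[? ->]; case: (cE b) => -[? ->]; lra. Qed.

Lemma itv_clamp (a b : R) : `]a, b] `&` `]0, 1] = `](c a), (c b)]%classic.
Proof.
apply/seteqP; split=> x; rewrite /= !in_itv/=.
  move=> [/andP[ax xb] /andP[x0 x1]].
  by apply/andP; split; case: (cE a) => -[? ca]; case: (cE b) => -[? cb];
    rewrite ?ca ?cb; lra.
move=> /andP[]; case: (cE a) => -[? ->]; case: (cE b) => -[? ->] ? ?;
by split; apply/andP; split; lra.
Qed.

End clamp.

Section quantile.
Context {R : realType} {d} {T : measurableType d} (P : probability T R)
  (I : finType) (a0 : I) (v : I -> {mfun T >-> R}) (f : I -> R -> R).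
Hypotheses (mf : forall a, measurable_fun setT (f a))
  (f0 : forall a y, 0 <= f a y).
Hypothesis vE : forall a (A : set R), measurable A ->
  distribution P (v a) A = (\int[lebesgue_measure]_(y in A) (f a y)%:E)%E.
Hypothesis v_itv : forall a, is_interval (range (v a)).
Hypothesis fv : forall a t, 0 < f a (v a t).
Hypothesis v_order : forall a a' t t',
  (v a t <= v a t') = (v a' t <= v a' t').
Local Notation mu := (@lebesgue_measure R).
Local Notation F a := (cdfR (v a : {RV P >-> R})).

(** The reference state [a0] is arbitrary: by [v_order] the types below a given one are the same in
    all states, whence [quantileE]. *)
Definition quantile t := F a0 (v a0 t).

Lemma quantileE a t : F a (v a t) = quantile t.
Proof.
apply: EFin_inj; rewrite -!cdfRE; congr (P _); apply/seteqP.
by split=> t' /=; rewrite (v_order a a0).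
Qed.

Lemma quantile_surj q : 0 < q < 1 -> exists t, quantile t = q.
Proof. by move=> q01; apply: (cdfR_attained (f := f a0)) => //; exact: vE. Qed.

Lemma quantile_lt a t t' : v a t < v a t' -> quantile t < quantile t'.
Proof.
by move=> tt'; rewrite -!(quantileE a);
  apply: (cdfR_lt (f := f a)) => //; exact: vE.
Qed.

Lemma le_quantile a t t' : quantile t <= quantile t' -> v a t <= v a t'.
Proof. by rewrite !leNgt; apply: contra; exact: quantile_lt. Qed.

Lemma quantile_ge0 t : 0 <= quantile t. Proof. exact: cdfR_ge0. Qed.

Lemma quantile_le1 t : quantile t <= 1. Proof. exact: cdfR_le1. Qed.

Lemma measurable_quantile : measurable_fun setT quantile.
Proof. by apply: measurableT_comp => //; exact: measurable_cdfR. Qed.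

Lemma is_interval_quantile : is_interval (range quantile).
Proof.
move=> _ _ [t _ <-] [t' _ <-] q /andP[tq qt'].
move: tq; rewrite le_eqVlt => /predU1P[<-|tq]; first by exists t.
move: qt'; rewrite le_eqVlt => /predU1P[->|qt']; first by exists t'.
have [|t1 <-] := @quantile_surj q; last by exists t1.
by rewrite (le_lt_trans (quantile_ge0 t))//= (lt_le_trans qt')// quantile_le1.
Qed.

(** Some type of quantile [q], uncontrolled if [q] is not attained. Types of equal quantile have
    equal values in every state by [le_quantile], so the choice is immaterial. *)
Definition type_of_quantile q : T := get [set t | quantile t = q].

Lemma type_of_quantileK q : range quantile q -> quantile (type_of_quantile q) = q.
Proof. by move=> [t _ tq]; exact: (@getI _ [set t | quantile t = q] t). Qed.

Lemma measurable_quantile_le q : measurable [set t | quantile t <= q].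
Proof.
rewrite (_ : mkset _ = quantile @^-1` `]-oo, q])//.
by rewrite -[X in measurable X]setTI; apply: measurable_quantile.
Qed.

Lemma quantile_cdf q :
  P [set t | quantile t <= q] = (Num.max 0 (Num.min 1 q))%:E.
Proof.
have H p : 0 < p < 1 -> P [set t | quantile t <= p] = p%:E.
  move=> p01; have [t tp] := quantile_surj p01.
  rewrite -[in RHS]tp /quantile -cdfRE; congr (P _); apply/seteqP.
  split=> t' /=; rewrite -tp; first exact: le_quantile.
  exact: cdfR_nd.
have [q1|q1] := leP 1 q.
  rewrite max_r// (_ : mkset _ = setT) ?probability_setT//.
  by apply/seteqP; split=> // t _ /=; rewrite (le_trans (quantile_le1 t)).
have [q0|q0] := leP q 0; last by rewrite H// q0.
apply/eqP; rewrite eq_le measure_ge0 andbT.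
have fP := fin_num_measure P _ (measurable_quantile_le q).
rewrite -(fineK fP) lee_fin leNgt; apply/negP => p0.
set p := fine _ in p0.
have p1 : p <= 1 by rewrite -lee_fin fineK// probability_le1//; exact: measurable_quantile_le.
(* The event [quantile t <= q] with [q <= 0] lies in the event [quantile t <= p / 2], whose mass is
   [p / 2] by [H]. *)
have : p <= p / 2.
  rewrite -lee_fin -(H (p / 2)); last by apply/andP; split; lra.
  rewrite fineK//; apply: le_measure; rewrite ?inE; try exact: measurable_quantile_le.
  by move=> t /= /le_trans; apply; lra.
by lra.
Qed.

(** Uniformity on []0, 1]], completed by Lebesgue measure off that interval: the left side is then a
    measure on the whole line that agrees with length on half-open intervals, and uniqueness of
    Lebesgue measure applies. *)
Lemma quantile_uniform (A : set R) : measurable A ->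
  (P (quantile @^-1` A) + mu (A `\` `]0%R, 1%R]%classic) = mu A)%E.
Proof.
move=> mA.
have mq : measurable_fun setT (quantile : T -> measurableTypeR R).
  exact: measurable_quantile.
pose m0 := [the measure _ _ of pushforward P (quantile : T -> measurableTypeR R)].
pose m1 := m0 mq.
have mC : measurable (~` `]0%R, 1%R]%classic : set (measurableTypeR R)).
  by apply: measurableC.
pose m2 := [the measure _ _ of mrestr mu mC].
pose m := [the measure _ _ of measure_add m1 m2].
have mE B : m B = (P (quantile @^-1` B) + mu (B `\` `]0%R, 1%R]%classic))%E.
  by rewrite /m /= /measure_add/= /msum !big_ord_recl big_ord0/= adde0.
rewrite -mE; apply/esym/(lebesgue_measure_unique (mu := m)) => // _ [[a b]] _ <- /=.
rewrite [RHS]mE.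
have [ba|ab] := leP b a.
  rewrite set_itv_ge ?bnd_simp -?leNgt// set0D preimage_set0 !measure0 adde0//.
have m01 : measurable (`]0, 1] : set (measurableTypeR R)) by [].
transitivity (mu (`]a, b] `\` `]0%R, 1%R]) + mu (`]a, b] `&` `]0%R, 1%R]))%E.
  exact: measureDI.
rewrite addeC; congr (_ + _)%E.
rewrite (itv_clamp a b) lebesgue_measure_itv/= lte_fin.
have cab := clamp_le (ltW ab).
pose c q : R := Num.max 0 (Num.min 1 q); rewrite -/(c a) -/(c b) in cab *.
have -> : P (quantile @^-1` `]a, b]) = (c b - c a)%:E.
  rewrite (_ : _ @^-1` _ = [set t | quantile t <= b] `\` [set t | quantile t <= a]).
    rewrite measureD; try exact: measurable_quantile_le; last first.
      rewrite (le_lt_trans (probability_le1 _ _)) ?ltry//.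
      exact: measurable_quantile_le.
    rewrite (_ : _ `&` _ = [set t | quantile t <= a]).
      by rewrite EFinB; congr (_ - _)%E; exact: quantile_cdf.
    apply/seteqP; split=> t /=; first by move=> [].
    by move=> ta; split => //; rewrite (le_trans ta)// ltW.
  apply/seteqP; split=> t /=; rewrite in_itv/=.
    by move=> /andP[at_ tb]; split => //; apply/negP; rewrite -ltNge.
  by move=> [-> /negP]; rewrite -ltNge => ->.
by case: ltP => // H; congr EFin; lra.
Qed.

Lemma ge0_integral_quantile (D : set R) (G : R -> \bar R) :
  measurable D -> D `<=` `]0, 1] -> measurable_fun D G ->
  (forall q, D q -> 0 <= G q)%E ->
  (\int[P]_(t in [set t | D (quantile t)]) G (quantile t) = \int[mu]_(q in D) G q)%E.
Proof.
move=> mD D01 mG G0.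
have mq : measurable_fun setT (quantile : T -> measurableTypeR R).
  exact: measurable_quantile.
have := @ge0_integral_pushforward _ _ _ _ _ _ mq P D G mD mG.
rewrite /comp/= => <-; last by move=> x /set_mem/G0.
apply: eq_measure_integral => A mA AD.
rewrite -[RHS](quantile_uniform mA) (_ : A `\` _ = set0) ?measure0 ?adde0//.
by apply/seteqP; split=> // x [/AD/D01].
Qed.

Lemma ae_quantile01 : {ae P, forall t, 0 < quantile t < 1}.
Proof.
pose I01 : set R := `]0, 1[%classic.
have mN : measurable (quantile @^-1` I01).
  rewrite -[X in measurable X]setTI; apply: measurable_quantile => //.
  exact: measurable_itv.
have PN : P (quantile @^-1` I01) = 1%E.
  have := quantile_uniform (measurable_itv `]0%R, 1%R[).
  rewrite (_ : _ `\` _ = set0); last first.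
    by apply/seteqP; split=> // x [] /=; rewrite !in_itv/= => /andP[-> /ltW ->] [].
  by rewrite measure0 adde0 => ->; rewrite lebesgue_measure_itv/= lte_fin ltr01 oppr0 adde0.
exists (~` (quantile @^-1` I01)); split; first exact: measurableC.
  by rewrite probability_setC// PN subee.
by move=> t /=; apply: contra_not; rewrite /I01 /= in_itv.
Qed.

Local Notation H := quantile.
Local Notation Hinv := type_of_quantile.

Let HK q : 0 < q < 1 -> H (Hinv q) = q.
Proof. by move=> /quantile_surj[t tq]; apply: type_of_quantileK; exists t. Qed.

(** [k] factors through the interval [range H], where monotone functions are measurable. *)
Lemma nondecreasing_quantile_measurable (k : T -> R) :
  (forall t t', H t <= H t' -> k t <= k t') ->
  measurable_fun (range H) (fun q => k (Hinv q)) /\ measurable_fun setT k.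
Proof.
move=> ndk.
have iH : is_interval (range H) by exact: is_interval_quantile.
have m1 : measurable_fun (range H) (fun q => k (Hinv q)).
  apply: nondecreasing_in_measurable => // x y Hx Hy xy.
  by apply: ndk; rewrite !type_of_quantileK.
split => //.
rewrite (_ : k = (fun q => k (Hinv q)) \o H); last first.
  apply/funext => t /=; apply/eqP; rewrite eq_le.
  by rewrite !ndk ?type_of_quantileK//; exists t.
apply: (@measurable_comp _ _ _ _ _ _ (range H)) => //.
- exact: is_interval_measurable.
- exact: measurable_quantile.
Qed.

Lemma range_quantile q : 0 < q < 1 -> range H q.
Proof. by move=> /quantile_surj[t tq]; exists t. Qed.

(** The range of [v a] being an interval, there are types with values just above [v a t]. Their
    quantiles strictly exceed [H t], so the shifted quantile eventually falls below them. *)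
Lemma cvg_quantile_shift a t (u : nat -> R) : 0 < H t < 1 ->
  (forall n, 0 < u n) -> u n @[n --> \oo] --> 0 ->
  v a (Hinv (H t + u n)) @[n --> \oo] --> v a t.
Proof.
move=> /andP[H0 H1] u0 cu.
(* The midpoint of [H t] and 1 yields a type strictly above [t]. *)
have [t1 t1E] : exists t1, H t1 = (1 + H t) / 2 by apply: quantile_surj; lra.
have vt1 : v a t < v a t1.
  rewrite ltNge; apply/negP => h; have : H t1 <= H t.
    by rewrite -!(quantileE a); exact: cdfR_nd.
  by rewrite t1E; lra.
apply/cvgrPdist_lt => e e0.
have [t2 vt2 t2e] : exists2 t2, v a t < v a t2 & v a t2 < v a t + e.
  have [h|h] := ltP (v a t1) (v a t + e); first by exists t1.
  have [t2 _ t2E] : range (v a) (v a t + e / 2).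
    by apply: (v_itv (x := v a t) (y := v a t1)); [exists t|exists t1|lra].
  by exists t2; rewrite t2E; lra.
have ut2 : \forall n \near \oo, u n < H t2 - H t.
  by apply: (cvgr_lt _ cu); rewrite subr_gt0; exact: quantile_lt vt2.
have u1 : \forall n \near \oo, u n < 1 - H t.
  by apply: (cvgr_lt _ cu); rewrite subr_gt0.
near=> n.
have un1 : u n < 1 - H t by near: n.
have un2 : u n < H t2 - H t by near: n.
have un0 := u0 n.
have K : H (Hinv (H t + u n)) = H t + u n by apply: HK; lra.
have h1 : v a t <= v a (Hinv (H t + u n)) by apply: le_quantile; rewrite K; lra.
have h2 : v a (Hinv (H t + u n)) <= v a t2 by apply: le_quantile; rewrite K; lra.
by rewrite ltr_norml; lra.
Unshelve. all: by end_near. Qed.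

(** Derivative of an inverse function: the quotient is the reciprocal of the difference quotient of
    [F a] at [v a t], for value increments that tend to 0. *)
Lemma cvg_quantile_quotient a t (u : nat -> R) : 0 < H t < 1 ->
  (forall n, 0 < u n) -> u n @[n --> \oo] --> 0 -> lebesgue_pt (f a) (v a t) ->
  (v a (Hinv (H t + u n)) - v a t) / u n @[n --> \oo] --> (f a (v a t))^-1.
Proof.
move=> tH u0 cu pt; have /andP[H0 H1] := tH.
have [dF dFE] := cdfR_derivable (mf a) (f0 a) (vE a) pt.
have cs := @cvg_quantile_shift a _ _ tH u0 cu.
have fv0 := fv a t; set w := v a t in dF dFE cs fv0 pt *.
have u1 : \forall n \near \oo, u n < 1 - H t.
  by apply: (cvgr_lt _ cu); rewrite subr_gt0.
(* The default 1, used only where [H t + u n] leaves the unit interval, keeps every increment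
   nonzero, as the sequential form of the punctured limit demands. *)
pose h n := if u n < 1 - H t then v a (Hinv (H t + u n)) - w else 1.
have K n : u n < 1 - H t -> H (Hinv (H t + u n)) = H t + u n.
  by move=> un; apply: HK; have := u0 n; lra.
have h0 n : h n != 0.
  rewrite /h; case: ifPn => [un|_]; last exact: oner_neq0.
  rewrite gt_eqF// subr_gt0 ltNge; apply/negP => le_w.
  have := @cdfR_nd _ _ _ P (v a) _ _ le_w; rewrite /w !(quantileE a).
  by rewrite K//; have := u0 n; lra.
have hE : \forall n \near \oo, v a (Hinv (H t + u n)) - w = h n.
  by near=> n; rewrite /h ifT//; near: n.
have ch : h n @[n --> \oo] --> 0.
  rewrite -(subrr w); apply: (cvg_trans (near_eq_cvg hE)).
  by apply: cvgB => //; exact: cvg_cst.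
have dF' : x^-1 *: (F a (x + w) - F a w) @[x --> 0^'] --> f a w.
  rewrite -dFE /derive1; move: dF; rewrite /derivable.
  rewrite (_ : (fun x => x^-1 *: ((F a \o shift w) (x *: 1) - F a w)) =
    (fun x : R => x^-1 *: (F a (x + w) - F a w)))//.
  by apply/funext => x; rewrite /= /GRing.scale/= mulr1.
have := (cvgr_dnbhsP _ _ _).1 dF' h (conj h0 ch).
move=> /cvgV => /(_ (lt0r_neq0 fv0)).
apply: cvg_trans; apply: near_eq_cvg; near=> n.
have un1 : u n < 1 - H t by near: n.
rewrite -(_ : h n = v a (Hinv (H t + u n)) - w); last by rewrite /h un1.
rewrite /= -[in LHS](_ : v a (Hinv (H t + u n)) = h n + w); last by rewrite /h un1 subrK.
rewrite !(quantileE a) K// addrC addKr.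
by rewrite /GRing.scale/= invfM invrK.
Unshelve. all: by end_near. Qed.

(** * Envelope inequality for a rent [U] with state-wise subgradient [A] *)

Variables (U : T -> R) (A : I -> T -> R).
Hypotheses (U0 : forall t, 0 <= U t) (A0 : forall a t, 0 <= A a t).
Hypothesis mA : forall a, measurable_fun setT (A a).
Hypothesis subgradient : forall t t',
  \sum_a A a t * (v a t' - v a t) <= U t' - U t.

Let U_le t t' : H t <= H t' -> U t <= U t'.
Proof.
move=> tt'; rewrite -subr_ge0 (le_trans _ (subgradient t t'))//.
by apply: sumr_ge0 => a _; rewrite mulr_ge0// subr_ge0 le_quantile.
Qed.

Let U_eq t t' : H t = H t' -> U t = U t'.
Proof. by move=> E; apply/eqP; rewrite eq_le !U_le// E. Qed.

Let mU : measurable_fun setT U.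
Proof. exact: (nondecreasing_quantile_measurable U_le).2. Qed.

(** A lower bound, by [subgradient], for the rent increase from [t] to a type [e] quantiles above,
    weighted by the mass above the latter. Divided by [e], it tends to the allocation times the
    inverse hazard rate as [e] vanishes. *)
Let gain (e : R) t := (1 - H t - e) *
  \sum_a A a t * (v a (Hinv (H t + e)) - v a t).

Let gain_ge0 e t : 0 < e -> 0 < H t < 1 - e -> 0 <= gain e t.
Proof.
move=> e0 /andP[H0 H1]; rewrite mulr_ge0//; first by lra.
apply: sumr_ge0 => a _; rewrite mulr_ge0// subr_ge0 le_quantile// HK; lra.
Qed.

Let mE e : measurable [set t | 0 < H t < 1 - e].
Proof.
rewrite (_ : mkset _ = H @^-1` `]0, (1 - e)[).
  by rewrite -[X in measurable X]setTI; apply: measurable_quantile.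
by apply/seteqP; split=> t /=; rewrite in_itv.
Qed.

Let mgain e : 0 < e -> measurable_fun [set t | 0 < H t < 1 - e] (gain e).
Proof.
move=> e0; have mH D : measurable_fun D H.
  by apply: measurable_funTS; exact: measurable_quantile.
apply: measurable_funM.
  by do 2 apply: measurable_funB => //.
apply: measurable_sum => a; apply: measurable_funM; first exact: measurable_funTS.
apply: measurable_funB; last exact: measurable_funTS.
have [mQ _] := nondecreasing_quantile_measurable (le_quantile a).
apply: (measurable_comp _ _ mQ) => //.
- by apply: is_interval_measurable; exact: is_interval_quantile.
- move=> _ [t /= /andP[tH0 tH1] <-]; apply: range_quantile; lra.
- exact: measurable_funD.
Qed.

(* Comparing the utility of each type with that of the type e quantiles above
   it, with weights chosen so that the sum telescopes. *)
Let gain_le (e : R) : 0 < e < 1 ->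
  (\int[P]_(t in [set t | (0 < H t < 1 - e)%R]) (gain e t)%:E
   <= e%:E * \int[P]_t (U t)%:E)%E.
Proof.
move=> /andP[e0 e1].
(* An infinite rent makes the bound trivial; a finite one makes [S] below finite, so that it may be
   added to both sides. *)
have [->|] := eqVneq (\int[P]_t (U t)%:E)%E +oo%E.
  by rewrite gt0_muley ?lte_fin// leey.
rewrite -ltey => Uoo.
set E := [set t | _]; have mEE : measurable E by exact: mE.
pose W q := U (Hinv q).
have WE t : W (H t) = U t by apply: U_eq; rewrite type_of_quantileK//; exists t.
have mW (D : set R) : D `<=` `]0, 1[ -> measurable_fun D W.
  move=> D01; apply: (@measurable_funS _ _ _ _ (range H)).
  - by apply: is_interval_measurable; exact: is_interval_quantile.
  - by move=> q /D01; rewrite /= in_itv/=; exact: range_quantile.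
  - exact: (nondecreasing_quantile_measurable U_le).1.
have mWc d' (T' : measurableType d') (D : set T') (k : T' -> R) :
    measurable_fun D k -> (forall x, D x -> 0 < k x < 1) ->
    measurable_fun D (fun x => W (k x)).
  move=> mk k01; apply: (measurable_comp _ _ (mW `]0, 1[%classic _)) => //.
  by move=> _ [x Dx <-]; rewrite /= in_itv/=; exact: k01.
have mH D : measurable_fun D H.
  by apply: measurable_funTS; exact: measurable_quantile.
pose S := (\int[P]_(t in E) ((1 - H t - e) * U t)%:E)%E.
have mS : measurable_fun E (fun t => (1 - H t - e) * U t).
  apply: measurable_funM; last exact: measurable_funTS.
  by do 2 apply: measurable_funB => //.
have S0 t : E t -> (0 <= ((1 - H t - e) * U t)%:E)%E.
  by move=> /andP[_ H1]; rewrite lee_fin mulr_ge0//; lra.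
have Sfin : S \is a fin_num.
  rewrite ge0_fin_numE ?integral_ge0//; apply: le_lt_trans Uoo.
  rewrite /S integral_mkcond; apply: ge0_le_integral => //.
  - by move=> t _; rewrite patchE; case: ifPn => // /set_mem/S0.
  - by apply/(measurable_restrictT _ _).1 => //; exact/measurable_EFinP.
  - exact/measurable_EFinP.
  move=> t _; rewrite patchE; case: ifPn => [/set_mem/andP[H0 H1]|_]; last by rewrite lee_fin.
  by rewrite lee_fin ler_piMl//; lra.
rewrite -(leeD2rE _ _ Sfin).
have -> : (\int[P]_(t in E) (gain e t)%:E + S =
   \int[P]_(t in E) (gain e t + (1 - H t - e) * U t)%:E)%E.
  rewrite /S -ge0_integralD//.
  - by move=> t Et; rewrite lee_fin gain_ge0.
  - by apply/measurable_EFinP; exact: mgain.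
  - exact/measurable_EFinP.
apply: (@le_trans _ _ (\int[P]_(t in E) ((1 - H t - e) * W (H t + e))%:E)%E).
  apply: ge0_le_integral => //.
  - by move=> t Et; rewrite lee_fin addr_ge0 ?gain_ge0// -lee_fin S0.
  - by apply/measurable_EFinP; apply: measurable_funD => //; exact: mgain.
  - apply/measurable_EFinP; apply: measurable_funM; first by do 2 apply: measurable_funB => //.
    apply: mWc; first exact: measurable_funD.
    by move=> t /= /andP[? ?]; lra.
  move=> t /= /andP[H0 H1]; rewrite lee_fin -mulrDr ler_wpM2l//; first by lra.
  by rewrite -lerBrDr; exact: subgradient.
have D1 : `]0, (1 - e)[ `<=` (`]0, 1] : set R).
  by move=> x; rewrite /= !in_itv/=; lra.
have mWe : measurable_fun (`]0, (1 - e)[ : set R) (fun q => W (q + e)).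
  apply: mWc; first exact: measurable_funD.
  by move=> q; rewrite /= in_itv/= => /andP[? ?]; lra.
rewrite [leLHS](_ : _ = \int[P]_(t in [set t | (`]0%R, (1 - e)%R[)%classic (H t)])
    ((1 - H t - e) * W (H t + e))%:E)%E; last first.
  by congr integral; apply/seteqP; split=> t /=; rewrite in_itv.
rewrite (ge0_integral_quantile
  (G := fun q => ((1 - q - e) * W (q + e))%:E))//; last 2 first.
- apply/measurable_EFinP; apply: measurable_funM => //.
  by do 2 apply: measurable_funB => //.
- move=> q; rewrite /= in_itv/= => q01; rewrite lee_fin.
  by apply: mulr_ge0; [lra|exact: U0].
(* The shift by [e] turns the weight [1 - q - e] at [q + e] into [G], whose formula is free of [e];
   its domain []e, 1[] is then enlarged to []0, 1[]. *)
pose G q := ((1 - q) * W q)%:E.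
have mG (D : set R) : measurable D -> D `<=` `]0, 1[ -> measurable_fun D G.
  move=> mD D01; apply/measurable_EFinP; apply: measurable_funM; last exact: mW.
  exact: measurable_funB.
have G0 q : `]0, 1[%classic q -> (0 <= G q)%E.
  rewrite /= in_itv/= => q01; rewrite lee_fin.
  by apply: mulr_ge0; [lra|exact: U0].
have De : `]e, 1[ `<=` (`]0, 1[ : set R).
  by move=> q; rewrite /= !in_itv/=; lra.
have -> : (\int[mu]_(q in `]0%R, (1 - e)%R[) ((1 - q - e) * W (q + e)%R)%:E
    = \int[mu]_(q in `]e, 1%R[) G q)%E.
  rewrite -(@ge0_integral_shift _ e `]e, 1[)//; last 2 first.
  - exact: mG.
  - by move=> q /De; exact: G0.
  rewrite (_ : `]0, (1 - e)[%classic = [set x : R | `]e, 1[%classic (x + e)]); last first.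
    by apply/seteqP; split=> x; rewrite /= !in_itv/=; lra.
  by apply: eq_integral => q _; rewrite /G; congr (_ * _)%:E; lra.
apply: (@le_trans _ _ (\int[mu]_(q in `]0%R, 1%R[) G q)%E).
  by apply: ge0_subset_integral => //; exact: mG.
rewrite -ge0_integral_quantile//; last 2 first.
- by move=> x; rewrite /= !in_itv/=; lra.
- exact: mG.
rewrite integral_mkcond /S -ge0_integralZl//; last 3 first.
- exact/measurable_EFinP.
- by move=> t _; rewrite lee_fin.
- by rewrite lee_fin ltW.
rewrite [in leRHS](integral_mkcond E) -ge0_integralD//; last 4 first.
- by move=> t _; rewrite mule_ge0 ?lee_fin ?U0// ltW.
- by apply: emeasurable_funM => //; exact/measurable_EFinP.
- by move=> t _; rewrite patchE; case: ifPn => // /set_mem/S0.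
- by apply/(measurable_restrictT _ _).1 => //; exact/measurable_EFinP.
apply: ge0_le_integral => //.
- by move=> t _; rewrite patchE; case: ifPn => // /set_mem; exact: G0.
- apply/(measurable_restrictT _ _).1.
    rewrite (_ : [set t | _] = [set t | 0 < H t < 1 - 0]); first exact: mE.
    by apply/seteqP; split=> t /=; rewrite in_itv/= subr0.
  rewrite (_ : (fun t => G (H t)) = fun t => ((1 - H t) * U t)%:E); last first.
    by apply/funext => t; rewrite /G WE.
  apply/measurable_EFinP; apply: measurable_funM; last exact: measurable_funTS.
  exact: measurable_funB.
- apply: emeasurable_funD; first by apply: emeasurable_funM => //; exact/measurable_EFinP.
  by apply/(measurable_restrictT _ _).1 => //; exact/measurable_EFinP.
move=> t _; rewrite !patchE; case: ifPn => [/set_mem|_]; last first.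
  case: ifPn => [/set_mem/S0 ?|_]; last by rewrite adde0 mule_ge0 ?lee_fin ?U0// ltW.
  by rewrite adde_ge0// mule_ge0 ?lee_fin ?U0// ltW.
(* With [q] the quantile: for [q < 1 - e] the weight [1 - q] is the sum of [e] and [1 - q - e]; from
   there on it is at most [e]. *)
rewrite /= in_itv/= => /andP[H0 H1]; rewrite /G WE -EFinM.
case: ifPn => [_|]; first by rewrite -EFinD lee_fin -mulrDl ler_wpM2r//; lra.
move=> /negP HE'; rewrite adde0 lee_fin ler_wpM2r//.
rewrite leNgt; apply/negP => H2; apply: HE'; apply/mem_set; rewrite /E /=; lra.
Qed.

Theorem envelope_ge :
  (\int[P]_t (\sum_a A a t * hazard_inv (v a : {RV P >-> R}) (f a) t)%:E
   <= \int[P]_t (U t)%:E)%E.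
Proof.
(* [n.+2] rather than [n.+1], so that [e n] is below 1 from the start. *)
pose e n : R := n.+2%:R^-1.
have e01 n : 0 < e n < 1 by rewrite invr_gt0 ltr0n/= invf_lt1 ?ltr0n// ltr1n.
pose E n := [set t | 0 < H t < 1 - e n].
pose g n := (fun t => ((e n)^-1 * gain (e n) t)%:E) \_ (E n).
have g0 n t : (0 <= g n t)%E.
  have /andP[? ?] := e01 n.
  rewrite /g patchE; case: ifPn => // /set_mem Et.
  by rewrite lee_fin mulr_ge0 ?invr_ge0 ?gain_ge0// ltW.
have mg n : measurable_fun setT (g n).
  have /andP[? ?] := e01 n.
  apply/(measurable_restrictT _ _).1 => //; first exact: mE.
  by apply/measurable_EFinP; apply: measurable_funM => //; exact: mgain.
have ig n : (\int[P]_t g n t <= \int[P]_t (U t)%:E)%E.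
  have /andP[? ?] := e01 n.
  rewrite -integral_mkcond.
  under eq_integral do rewrite EFinM.
  rewrite ge0_integralZl_EFin//; last 4 first.
  - exact: mE.
  - by move=> t Et; rewrite lee_fin gain_ge0.
  - by apply/measurable_EFinP; exact: mgain.
  - by rewrite invr_ge0 ltW.
  by rewrite lee_pdivrMl//; exact: gain_le.
have mh : measurable_fun setT
    (fun t => \sum_a A a t * hazard_inv (v a : {RV P >-> R}) (f a) t).
  apply: measurable_sum => a; apply: measurable_funM => //.
  exact: measurable_hazard_inv.
apply: (@le_trans _ _ (\int[P]_t limn_einf (g^~ t))%E).
  apply: ae_ge0_le_integral => //.
  - move=> t _; rewrite lee_fin; apply: sumr_ge0 => a _.
    by rewrite mulr_ge0// hazard_inv_ge0.
  - exact/measurable_EFinP.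
  - move=> t _; rewrite limn_einf_lim; apply: lime_ge; first exact: is_cvg_einfs.
    by apply: nearW => n; apply: le_ereal_inf_tmp => _ [m /= _ <-]; exact: g0.
  - apply: measurableT_comp => //; apply: measurable_fun_limn_esup => n.
    exact: measurableT_comp.
  have ae1 := ae_quantile01.
  have ae2 : {ae P, forall t, forall a, lebesgue_pt (f a) (v a t)}.
    apply: filter_forall => a.
    exact: ae_lebesgue_pt_rv (mf a) (f0 a) (vE a).
  apply: filterS2 ae1 ae2 => t t01 tpt _.
  have /andP[H0 H1] := t01.
  have ce : e n @[n --> \oo] --> 0.
    rewrite (_ : e = fun n => [sequence harmonic (n + 1)%N]_n n); last first.
      by apply/funext => n; rewrite /e /= addn1.
    by rewrite (cvg_shiftn 1 (@harmonic R)); exact: cvg_harmonic.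
  have e0 n : 0 < e n by have /andP[] := e01 n.
  (* The value is a Lebesgue point of the density in every state, so each quotient converges to the
     reciprocal density; [1 - H t] is [1 - F] in every state at once. *)
  have cg : g n t @[n --> \oo] -->
      ((1 - H t) * \sum_a A a t * (f a (v a t))^-1)%:E.
    have e1 : \forall n \near \oo, e n < 1 - H t.
      by apply: (cvgr_lt _ ce); rewrite subr_gt0.
    apply: (@cvg_trans _ ((((1 - H t - e n) *
      \sum_a A a t * ((v a (Hinv (H t + e n)) - v a t) / e n))%:E) @[n --> \oo])).
      apply: near_eq_cvg; near=> n; rewrite /g patchE mem_set.
        congr EFin; rewrite /gain mulrCA; congr (_ * _); rewrite mulr_sumr.
        by apply: eq_bigr => a _; rewrite [RHS]mulrC mulrA.
      have en : e n < 1 - H t by near: n.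
      by rewrite /E /=; lra.
    apply/cvg_EFin; first exact: nearW.
    apply: cvgM.
      rewrite -[X in _ --> X]subr0; apply: cvgB => //; exact: cvg_cst.
    apply: cvg_big => [|a _]; first exact: add_continuous.
    apply: cvgM; first exact: cvg_cst.
    exact: cvg_quantile_quotient.
  rewrite (cvg_limn_einf_sup cg).1 lee_fin mulr_sumr.
  apply: ler_sum => a _; rewrite /hazard_inv quantileE.
  by rewrite mulrCA.
apply: (@le_trans _ _ (limn_einf (fun n => \int[P]_t g n t)%E)).
  exact: fatou.
rewrite limn_einf_lim; apply: lime_le; first exact: is_cvg_einfs.
apply: nearW => n; apply: le_trans (ig n); apply: ereal_inf_lbound.
by exists n => /=.
Unshelve. all: by end_near. Qed.

End quantile.

(** * Product probabilities and resampling of one coordinate *)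

Lemma ae_imply (R : realType) d (T : measurableType d)
    (mu : {measure set T -> \bar R}) (A B : T -> Prop) :
  (forall x, A x -> B x) -> {ae mu, forall x, A x} -> {ae mu, forall x, B x}.
Proof.
move=> AB [N [mN N0 NA]]; exists N; split=> // x /= Bx.
by apply: NA => /= Ax; exact: Bx (AB _ Ax).
Qed.

Lemma integral_prob_cst (R : realType) d (T : measurableType d)
    (P : probability T R) (c : \bar R) : (\int[P]__ c = c)%E.
Proof.
rewrite integral_cst// -[RHS]mule1; congr (_ * _)%E; exact: probability_setT.
Qed.

Lemma pcons0 n (T : 'I_n.+1 -> Type) z : @pcons n T z ord0 = z.1.
Proof.
rewrite /pcons; case: (unliftP ord0 ord0) => [j e|e].
  by exfalso; move: (neq_lift ord0 j); rewrite -e eqxx.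
by rewrite (eq_irrelevance e erefl).
Qed.

Lemma pcons_lift n (T : 'I_n.+1 -> Type) z i : @pcons n T z (lift ord0 i) = z.2 i.
Proof.
rewrite /pcons; case: (unliftP ord0 (lift ord0 i)) => [j e|e].
  have ij := lift_inj e; subst j.
  by rewrite (eq_irrelevance e erefl).
by exfalso; move: (neq_lift ord0 i); rewrite e eqxx.
Qed.

Section product_probability.
Context {R : realType} {n : nat} {d : 'I_n -> measure_display}
  {T : forall i, measurableType (d i)} (P : forall i, probability (T i) R).
Local Notation PP := (prod_probability P).

Definition box (A : forall i, set (T i)) : set (profile T) :=
  [set t | forall i, A i (t i)].

(** Unlike the cylinders that generate the sigma-algebra, boxes are closed under intersection, as
    uniqueness of measures requires. *)
Definition boxes : set (set (profile T)) :=
  [set B | exists2 A, forall i, measurable (A i) & B = box A].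

Lemma measurable_boxes : measurable = <<s boxes >> :> set (set (profile T)).
Proof.
apply/seteqP; split.
  apply: smallest_sub; first exact: smallest_sigma_algebra.
  move=> B [i _ [A mA <-]]; apply: sub_sigma_algebra.
  exists (dfwith (fun j => [set: T j]) i A).
    by move=> j; case: dfwithP => // *; exact: measurableT.
  rewrite setTI; apply/seteqP; split=> t /=.
    by move=> tA j; case: dfwithP.
  by move=> /(_ i); rewrite dfwithin.
apply: smallest_sub; first exact: sigma_algebra_measurable.
by move=> B [A mA ->]; exact: measurable_box.
Qed.

Lemma prod_probability_unique (m : {measure set (profile T) -> \bar R}) :
  (forall A : forall i, set (T i), (forall i, measurable (A i)) ->
    m (box A) = (\prod_i P i (A i))%E) ->
  forall B, measurable B -> PP B = m B.
Proof.
move=> mE; apply: (measure_unique boxes (fun=> setT)) => //.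
- exact: measurable_boxes.
- move=> _ _ [A mA ->] [A' mA' ->]; exists (fun i => A i `&` A' i).
    by move=> i; exact: measurableI.
  by apply/seteqP; split=> t /=; [move=> [tA tA'] i|move=> tA; split=> i; have [] := tA i].
- by move=> _; exists (fun=> setT) => //; apply/seteqP; split.
- by apply/seteqP; split=> // t _; exists 0%N.
- by move=> _ [A mA ->]; rewrite mE// -prod_probabilityE.
- by move=> _; rewrite (le_lt_trans (probability_le1 _ _))// ltry.
Qed.

Lemma measurable_dfwith i :
  measurable_fun setT (fun z : profile T * T i => dfwith z.1 i z.2 : profile T).
Proof.
apply: measurable_profile => j; have [<-|ij] := eqVneq i j.
  by apply: (eq_measurable_fun snd) => // z _; rewrite dfwithin.
apply: (eq_measurable_fun (fun z : profile T * T i => z.1 j)).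
  by move=> z _; rewrite dfwithout.
exact: (measurableT_comp (@measurable_coord _ _ _ j)).
Qed.

Lemma measurable_dfwith_own (t : profile T) i :
  measurable_fun setT (fun b : T i => dfwith t i b : profile T).
Proof.
have mp : measurable_fun setT (fun b : T i => (t, b)) by exact: measurable_fun_pair.
exact: (measurableT_comp (@measurable_dfwith i) mp).
Qed.

Lemma measurable_integral_dfwith i (G : profile T -> \bar R) :
  measurable_fun setT G -> (forall t, 0 <= G t)%E ->
  measurable_fun setT (fun t : profile T => \int[P i]_b G (dfwith t i b))%E.
Proof.
move=> mG G0; apply: (@measurable_fun_fubini_tonelli_F _ _ _ _ _ (P i)
  (fun z : profile T * T i => G (dfwith z.1 i z.2))).
  exact: (measurableT_comp mG (@measurable_dfwith i)).
by move=> z; exact: G0.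
Qed.

(** Redrawing coordinate [i] independently leaves the product law unchanged, which is checked on
    boxes. This gives Fubini in any one coordinate without splitting the dependent product. *)
Lemma ge0_integral_resample i (G : profile T -> \bar R) :
  measurable_fun setT G -> (forall t, 0 <= G t)%E ->
  (\int[PP]_t G t = \int[PP]_t \int[P i]_b G (dfwith t i b))%E.
Proof.
move=> mG G0.
pose df := fun z : profile T * T i => dfwith z.1 i z.2 : profile T.
have mdf : measurable_fun setT df by exact: measurable_dfwith.
pose m0 := [the measure _ _ of pushforward (PP \x P i)%E df].
pose m := m0 mdf.
have PPm B : measurable B -> PP B = m B.
  apply: prod_probability_unique => A mA.
  rewrite /m /m0 /= /pushforward.
  rewrite (_ : df @^-1` box A = box (dfwith A i setT) `*` A i); last first.
    apply/seteqP; split=> -[t b] /=; rewrite /df /box /=.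
      move=> tA; split; last by have := tA i; rewrite dfwithin.
      by move=> j; have [<-|ij] := eqVneq i j; rewrite ?dfwithin// dfwithout//;
        have := tA j; rewrite dfwithout.
    move=> [tA bA] j; have [<-|ij] := eqVneq i j; rewrite ?dfwithin//.
    by rewrite dfwithout//; have := tA j; rewrite dfwithout.
  have mA' j : measurable (dfwith A i setT j).
    by have [<-|ij] := eqVneq i j; rewrite ?dfwithin// dfwithout.
  rewrite product_measure1E//; last exact: measurable_box.
  transitivity ((\prod_j P j (dfwith A i setT j)) * P i (A i))%E.
    by congr (_ * _)%E; exact: prod_probabilityE.
  rewrite (bigD1 i)//= dfwithin probability_setT mul1e.
  rewrite [RHS](bigD1 i)//= muleC; congr (_ * _)%E.
  by apply: eq_bigr => j ji; rewrite dfwithout// eq_sym.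
rewrite (eq_measure_integral m) => [|A mA _]; last exact: PPm.
rewrite ge0_integral_pushforward//=.
rewrite fubini_tonelli1//=.
by apply: measurableT_comp.
Qed.

Lemma prod_probability_coord i (A : set (T i)) : measurable A ->
  PP [set t | A (t i)] = P i A.
Proof.
move=> mA; have mA' j : measurable (dfwith (fun j => [set: T j]) i A j).
  by have [<-|ij] := eqVneq i j; rewrite ?dfwithin// dfwithout.
rewrite (_ : mkset _ = box (dfwith (fun j => [set: T j]) i A)); last first.
  apply/seteqP; split=> t /=; last by move=> /(_ i); rewrite dfwithin.
  by move=> tA j; case: dfwithP.
rewrite /box prod_probabilityE// (bigD1 i)//= dfwithin big1 ?mule1// => j ji.
by rewrite dfwithout ?probability_setT// eq_sym.
Qed.

Lemma ae_coord i (Q : T i -> Prop) :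
  {ae P i, forall x, Q x} -> {ae PP, forall t, Q (t i)}.
Proof.
move=> [N [mN N0 NQ]]; exists [set t | N (t i)]; split.
- by rewrite -[X in measurable X]setTI; exact: measurable_coord.
- by rewrite -N0; exact: prod_probability_coord.
- by move=> t /= /NQ.
Qed.

Lemma ge0_integral_coord i (G : T i -> \bar R) :
  measurable_fun setT G -> (forall t, 0 <= G t)%E ->
  (\int[PP]_t G (t i) = \int[P i]_x G x)%E.
Proof.
move=> mG G0; rewrite (ge0_integral_resample i)//; last first.
  exact: (measurableT_comp mG (@measurable_coord _ _ _ i)).
under eq_integral do under eq_integral do rewrite dfwithin.
exact: integral_prob_cst.
Qed.

End product_probability.

Lemma ge0_integral_prod (R : realType) n (d : 'I_n -> measure_display)
    (T : forall i, measurableType (d i)) (P : forall i, probability (T i) R)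
    (k : forall i, T i -> R) :
  (forall i, measurable_fun setT (k i)) -> (forall i x, 0 <= k i x) ->
  (\int[prod_probability P]_t (\prod_i k i (t i))%:E
   = \prod_i \int[P i]_x (k i x)%:E)%E.
Proof.
elim: n d T P k => [|n IH] d T P k mk k0.
  under eq_integral do rewrite big_ord0.
  by rewrite big_ord0; exact: integral_prob_cst.
rewrite big_ord_recl -IH//=.
set PP := prod_probability _.
have mprod : measurable_fun setT (fun t : profile T => (\prod_i k i (t i))%:E).
  apply/measurable_EFinP; apply: measurable_prod => i _.
  exact: (measurableT_comp (mk i) (@measurable_coord _ _ _ i)).
have mprod' : measurable_fun setT
    (fun t : profile (fun i => T (lift ord0 i)) =>
      (\prod_(i < n) k (lift ord0 i) (t i))%:E).
  apply/measurable_EFinP; apply: measurable_prod => i _.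
  exact: (measurableT_comp (mk _) (@measurable_coord _ _ (fun i => T (lift ord0 i)) i)).
have p0 (t : profile T) : (0 <= (\prod_i k i (t i))%:E)%E.
  by rewrite lee_fin prodr_ge0.
rewrite (ge0_integral_distribution _ mprod)//.
rewrite fubini_tonelli1//=; last exact: measurableT_comp.
rewrite /fubini_F/=.
transitivity (\int[P ord0]_x ((k ord0 x)%:E *
    \int[PP]_t (\prod_(i < n) k (lift ord0 i) (t i))%:E))%E.
  apply: eq_integral => x _; rewrite -ge0_integralZl ?lee_fin//; last first.
    by move=> t _; rewrite lee_fin prodr_ge0.
  apply: eq_integral => t _; rewrite big_ord_recl pcons0 EFinM; congr (_ * _%:E)%E.
  by apply: eq_bigr => i _; rewrite pcons_lift.
rewrite ge0_integralZr//.
- exact/measurable_EFinP.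
- by move=> x _; rewrite lee_fin.
- by apply: integral_ge0 => t _; rewrite lee_fin prodr_ge0.
Qed.

(** * Beliefs on a finite set: outcomes and garblings *)

Section finite_distributions.
Context {R : realType} (X : pfinType).
Implicit Types s : dist R X.

Lemma dist_ge0 s x : 0 <= s x.
Proof. by case: s => p /= /andP[/forallP]. Qed.

Lemma dist_sum1 s : \sum_x s x = 1.
Proof. by case: s => p /= /andP[_ /eqP]. Qed.

Lemma measurable_dist_coord x : measurable_fun setT (fun s => s x).
Proof.
move=> _ A mA; apply: sub_sigma_algebra; exists x => //.
by exists A.
Qed.

Lemma measurable_dist d' (Y : measurableType d') (k : Y -> dist R X) :
  (forall x, measurable_fun setT (fun y => k y x)) -> measurable_fun setT k.
Proof.
move=> mk; apply: (@measurability _ _ _ _ _ _ (@dist_cylinders R X)) => //.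
move=> _ [_ [x _ [A mA <-]] <-]; rewrite setTI -comp_preimage setTI.
by have := mk x measurableT A mA; rewrite setTI.
Qed.

(** A belief outside the support has a null neighbourhood, hence lies in a null cube with rational
    centre and radius [m.+1%:R^-1]; there are countably many such cubes. *)
Lemma ae_outcome (tau : probability (dist R X) R) :
  {ae tau, forall s, outcome tau s}.
Proof.
pose cube (q : {ffun X -> rat} * nat) := [set s : dist R X |
  forall x, `|s x - ratr (q.1 x)| < q.2.+1%:R^-1].
have mball (c : X -> R) r : measurable [set s : dist R X | forall x, `|s x - c x| < r].
  rewrite (_ : mkset _ = \bigcap_(x in [set: X]) [set s : dist R X |
      `|s x - c x| < r]); last first.
    by apply/seteqP; split=> [s sq x _|s sq x]; exact: sq.
  apply: fin_bigcap_measurable => [|x _]; first exact: finite_finset.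
  have mn : measurable_fun setT (fun s : dist R X => `|s x - c x|).
    apply: measurableT_comp => //; apply: measurable_funB => //.
    exact: measurable_dist_coord.
  have := mn measurableT `]-oo, r[%classic (measurable_itv _).
  by rewrite setTI; congr measurable; apply/seteqP; split=> s /=; rewrite in_itv.
have mcube q : measurable (cube q) by exact: mball.
pose N (k : nat) := if unpickle k is Some q then
  if tau (cube q) == 0%E then cube q else set0 else set0.
have : tau.-negligible (\bigcup_k N k).
  apply: negligible_bigcup => k; rewrite /N; case: unpickle => [q|]; last first.
    exact: negligible_set0.
  case: ifPn => [/eqP q0|_]; last exact: negligible_set0.
  by apply/negligibleP.
apply: negligibleS => s; rewrite /outcome /= => /existsNP[e /not_implyP[e0 /negP]].
rewrite -leNgt => le0.
(* Half of [e]: two points of a cube of this radius are less than [e] apart. *)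
have [m me] : exists m : nat, m.+1%:R^-1 < e / 2.
  have e2 : 0 < e / 2 by rewrite divr_gt0.
  by have /filter_ex[m me] := near_infty_natSinv_lt (PosNum e2); exists m.
have m0 : 0 < m.+1%:R^-1 :> R by rewrite invr_gt0.
have /choice[q qs] : forall x, exists q : rat, `|s x - ratr q| < m.+1%:R^-1.
  move=> x; have [|q] := @rat_in_itvoo R (s x - m.+1%:R^-1) (s x + m.+1%:R^-1).
    by rewrite ltrD2l (lt_trans _ m0)// oppr_lt0.
  by rewrite in_itv/= => q01; exists q; rewrite ltr_distlC.
pose c := ([ffun x => q x], m).
exists (pickle c) => //; rewrite /N pickleK.
have cs : cube c s by move=> x; rewrite /= ffunE.
suff -> : tau (cube c) = 0%E by rewrite eqxx.
apply/eqP; rewrite eq_le measure_ge0 andbT; apply: le_trans le0.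
apply: le_measure; rewrite ?inE//.
move=> s' cs' x; have := cs' x; have := cs x; rewrite /= !ffunE !ltr_distl.
move: me; move: (m.+1%:R^-1 : R) => r re /andP[? ?] /andP[? ?].
by apply/andP; split; lra.
Qed.

(** The diagonal coupling. It makes full revelation an admissible choice, so that incentive
    compatibility specialises to pure misreports of the type. *)
Lemma MPS_refl (tau : probability (dist R X) R) : MPS tau tau.
Proof.
have mdiag : measurable_fun setT (fun s : dist R X => (s, s)).
  exact: measurable_fun_pair.
pose diag := @mfun_Sub _ _ (dist R X) (dist R X * dist R X)%type _ (mem_set mdiag).
exists (distribution tau diag); split=> // A mA x.
have mA2 : measurable (snd @^-1` A : set (dist R X * dist R X)).
  by rewrite -[X in measurable X]setTI; exact: measurable_snd.
rewrite !ge0_integral_pushforward//=.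
- apply/measurable_EFinP; apply: measurable_funTS.
  exact: (measurableT_comp (measurable_dist_coord x)).
- by move=> z _; rewrite lee_fin dist_ge0.
- apply/measurable_EFinP; apply: measurable_funTS.
  exact: (measurableT_comp (measurable_dist_coord x)).
- by move=> z _; rewrite lee_fin dist_ge0.
Qed.

End finite_distributions.

(** * The joint law of states and signals *)

Section signals.
Context {R : realType} {n : nat} {Theta : 'I_n -> pfinType}.
Variable g : dist R (state_profile Theta).
Implicit Types (s : signal_profile R Theta) (th : state_profile Theta)
  (lam tau : forall i, probability (dist R (Theta i)) R).
Local Notation D := (state_signal_density g).

Lemma marginal_ge0 i (a : Theta i) : 0 <= marginal g a.
Proof. by apply: sumr_ge0 => th _; exact: dist_ge0. Qed.

Lemma marginal_gt0 th i : 0 < g th -> 0 < marginal g (th i).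
Proof.
move=> g0; rewrite (lt_le_trans g0)// /marginal (bigD1 th)//= lerDl.
by apply: sumr_ge0 => th' _; exact: dist_ge0.
Qed.

Lemma state_signal_density_ge0 th s : 0 <= D th s.
Proof.
rewrite mulr_ge0 ?dist_ge0// prodr_ge0// => i _.
by rewrite divr_ge0 ?dist_ge0// marginal_ge0.
Qed.

Lemma signal_density_ge0 s : 0 <= signal_density g s.
Proof. by apply: sumr_ge0 => th _; exact: state_signal_density_ge0. Qed.

Lemma measurable_state_signal_density th : measurable_fun setT (D th).
Proof.
apply: measurable_funM => //; apply: measurable_prod => i _.
apply: measurable_funM => //.
exact: (measurableT_comp (measurable_dist_coord _) (@measurable_coord _ _ _ i)).
Qed.

Lemma measurable_signal_density : measurable_fun setT (signal_density g).
Proof. by apply: measurable_sum => th; exact: measurable_state_signal_density. Qed.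

Lemma posteriorE s th : posterior g s th =
  if 0 < signal_density g s then D th s / signal_density g s else g th.
Proof.
rewrite /posterior; case: ifPn => [s0|].
  rewrite /insubd insubT /=; last by rewrite ffunE.
  apply/andP; split.
    apply/forallP => th'; rewrite ffunE divr_ge0 ?signal_density_ge0//.
    exact: state_signal_density_ge0.
  under eq_bigr do rewrite ffunE.
  by rewrite -mulr_suml divff// gt_eqF.
rewrite lt_neqAle signal_density_ge0 andbT negbK eq_sym => /eqP s0.
(* At density 0 all quotients are 0 and do not sum to 1, so [insubd] returns the prior. *)
rewrite /insubd insubN//; apply/negP => /andP[_].
under eq_bigr do rewrite ffunE s0 invr0 mulr0.
by rewrite big1// eq_sym oner_eq0.
Qed.

(** Valid also where the density vanishes, since every nonnegative [D th s] then vanishes. Utilities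
    weighted by the signal density thus become sums over states with weights [D th s]. *)
Lemma signal_densityM s th : signal_density g s * posterior g s th = D th s.
Proof.
rewrite posteriorE; case: ifPn => [s0|].
  by rewrite mulrC divfK// gt_eqF.
rewrite lt_neqAle signal_density_ge0 andbT negbK => /eqP s0.
rewrite -s0 mul0r; apply/esym/eqP; rewrite eq_le state_signal_density_ge0 andbT.
rewrite [leRHS]s0 /signal_density (bigD1 th)//= lerDl sumr_ge0// => th' _.
exact: state_signal_density_ge0.
Qed.

Lemma measurable_posterior : measurable_fun setT (posterior g).
Proof.
apply: measurable_dist => th.
apply: (eq_measurable_fun (fun s => if 0 < signal_density g s
  then D th s / signal_density g s else g th)).
  by move=> s _; rewrite posteriorE.
apply: measurable_fun_ifT => //.
- by apply: measurable_fun_ltr => //; exact: measurable_signal_density.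
- apply: measurable_funM; first exact: measurable_state_signal_density.
  by apply: (measurableT_comp measurable_inv); exact: measurable_signal_density.
Qed.

Lemma integral_state_signal_density lam th :
  (forall i, is_experiment g (lam i)) ->
  (\int[prod_probability lam]_s (D th s)%:E = (g th)%:E)%E.
Proof.
move=> lamE; have [g0|g0] := eqVneq (g th) 0.
  by rewrite integral0_eq ?g0// => s _; rewrite /D g0 mul0r.
have gt0 : 0 < g th by rewrite lt_neqAle eq_sym g0 dist_ge0.
under eq_integral do rewrite /state_signal_density EFinM.
rewrite ge0_integralZl ?lee_fin ?dist_ge0//; last 2 first.
- apply/measurable_EFinP; apply: measurable_prod => i _.
  apply: measurable_funM => //.
  exact: (measurableT_comp (measurable_dist_coord _) (@measurable_coord _ _ _ i)).
- move=> s _; rewrite lee_fin prodr_ge0// => i _.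
  by rewrite divr_ge0 ?dist_ge0// marginal_ge0.
rewrite (@ge0_integral_prod _ _ _ (fun i => dist R (Theta i)) lam
  (fun i si => si (th i) / marginal g (th i))); last 2 first.
- by move=> i; apply: measurable_funM => //; exact: measurable_dist_coord.
- by move=> i si; rewrite divr_ge0 ?dist_ge0// marginal_ge0.
rewrite big1 ?mule1// => i _.
under eq_integral do rewrite EFinM.
rewrite ge0_integralZr//.
- by rewrite lamE -EFinM divff// gt_eqF// marginal_gt0.
- by apply/measurable_EFinP; exact: measurable_dist_coord.
- by move=> si _; rewrite lee_fin dist_ge0.
- by rewrite lee_fin invr_ge0 marginal_ge0.
Qed.

Lemma posterior_support s th : 0 < signal_density g s -> 0 < posterior g s th ->
  0 < g th /\ forall i, 0 < s i (th i).
Proof.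
move=> s0; rewrite posteriorE s0 => p0.
have D0 : D th s != 0 by apply: contraTneq p0 => ->; rewrite mul0r ltxx.
split; first by rewrite lt_neqAle dist_ge0 andbT eq_sym;
  apply: contra D0 => /eqP g0; rewrite /state_signal_density g0 mul0r.
move=> i; rewrite lt_neqAle dist_ge0 andbT eq_sym; apply: contra D0 => /eqP si0.
by rewrite /state_signal_density (bigD1 i)//= si0 !mul0r mulr0.
Qed.

(** The martingale clause of the coupling, taken on the whole space, equates the two means. *)
Lemma MPS_experiment i (tau lam : probability (dist R (Theta i)) R) :
  is_experiment g tau -> MPS tau lam -> is_experiment g lam.
Proof.
move=> tauE [gam [g1 g2 g3]] a; rewrite -tauE.
have coord (P : probability (dist R (Theta i)) R)
    (k : dist R (Theta i) * dist R (Theta i) -> dist R (Theta i)) :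
    measurable_fun setT k ->
    (forall A, measurable A -> gam (k @^-1` A) = P A) ->
    (\int[gam]_z (k z a)%:E = \int[P]_s (s a)%:E)%E.
  move=> mk kP.
  pose m0 := [the measure _ _ of pushforward gam k].
  rewrite -(@eq_measure_integral _ _ _ _ P (m0 mk)); last first.
    by move=> A mA _; exact: kP.
  rewrite ge0_integral_pushforward//.
  - by apply/measurable_EFinP; exact: measurable_dist_coord.
  - by move=> s _; rewrite lee_fin dist_ge0.
have := g3 setT measurableT a; rewrite preimage_setT.
by rewrite (coord tau fst)// (coord lam snd).
Qed.

End signals.

(** * The state-wise Myerson auction *)

Section critical_values.
Context {R : realType} {n : nat} {d : 'I_n -> measure_display}
  {T : forall i, measurableType (d i)} {Theta : 'I_n -> pfinType}.
Variables (v : forall i, Theta i -> {mfun T i >-> R})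
  (h : forall i, probability (T i) R) (f : forall i, Theta i -> R -> R)
  (prio : {perm 'I_n}).
Local Notation phi := (virtual_value v h f).
Local Notation win := (wins v h f prio).
Local Notation thr := (threshold v h f).
Local Notation cv := (critical_value v h f).
Hypothesis f_density : is_value_density v h f.
Hypothesis reg_virtual : regular_virtual_values v h f.
Implicit Types (b t : profile T) (th : state_profile Theta).

Lemma virtual_valueE i (x : T i) (a : Theta i) :
  phi x a = v a x - hazard_inv (v a : {RV (h i) >-> R}) (f a) x.
Proof. by []. Qed.

Lemma virtual_value_le i (x : T i) (a : Theta i) : phi x a <= v a x.
Proof.
rewrite virtual_valueE lerBlDr lerDl hazard_inv_ge0//.
by move=> y; have [_ + _] := f_density a; exact.
Qed.

Lemma le_virtual_value i (x x' : T i) (a a' : Theta i) :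
  (phi x a <= phi x' a') = (v a x <= v a' x').
Proof. by rewrite reg_virtual. Qed.

Lemma measurable_virtual_value i (a : Theta i) :
  measurable_fun setT (fun x : T i => phi x a).
Proof.
have [mf _ _] := f_density a.
by apply: measurable_funB => //; exact: measurable_hazard_inv.
Qed.

Section critical_value_spec.
Context i (a : Theta i) (y : R).
Hypotheses (y0 : 0 <= y) (y_le : exists x, y <= phi x a).
Let S := [set v a x | x in [set x : T i | y < phi x a]].

(* The two branches of [critical_value] merge into the infimum of the values
   whose virtual value is at least y. *)
Let critical_cases : (exists2 x0, phi x0 a = y & cv a y = v a x0) \/
  [/\ forall x, phi x a != y, cv a y = inf S & has_inf S].
Proof.
rewrite /critical_value; case: ifPn => [/asboolP [x0 x0y]|/asboolPn H].
  left; exists (get [set x : T i | phi x a = y]) => //.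
  exact: (@getI _ [set x : T i | phi x a = y] x0).
right; have neq x : phi x a != y.
  by apply/eqP => xy; apply: H; exists x.
split => //; split.
  have [x yx] := y_le; exists (v a x); exists x => //=.
  by rewrite lt_neqAle yx andbT eq_sym neq.
(* A value is at least its virtual value, which exceeds [y >= 0]; hence 0 bounds [S] from below and
   [inf S] is a genuine infimum. *)
exists 0 => _ [x /= yx <-].
by rewrite (le_trans _ (virtual_value_le x a))// (le_trans y0)// ltW.
Qed.

Lemma critical_value_le x : y <= phi x a -> cv a y <= v a x.
Proof.
move=> yx; have [[x0 x0y ->]|[neq -> [_ S0]]] := critical_cases.
  by rewrite -le_virtual_value x0y.
by apply: ge_inf => //; exists x => //=; rewrite lt_neqAle yx andbT eq_sym neq.
Qed.

Lemma critical_value_ge x : phi x a <= y -> v a x <= cv a y.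
Proof.
move=> xy; have [[x0 x0y ->]|[neq -> [S0 _]]] := critical_cases.
  by rewrite -le_virtual_value x0y.
apply: lb_le_inf => // _ [x' /= yx' <-].
by rewrite -le_virtual_value (le_trans xy)// ltW.
Qed.

Lemma critical_value_ge0 : 0 <= cv a y.
Proof.
have [[x0 x0y ->]|[neq -> [S0 _]]] := critical_cases.
  by rewrite (le_trans _ (virtual_value_le _ _))// x0y.
apply: lb_le_inf => // _ [x' /= yx' <-].
by rewrite (le_trans _ (virtual_value_le x' a))// (le_trans y0)// ltW.
Qed.

Lemma critical_value_approx z : cv a y < z ->
  exists2 x, y <= phi x a & v a x <= z.
Proof.
have [[x0 x0y ->]|[neq -> Sinf]] := critical_cases.
  by move=> z0; exists x0; rewrite ?x0y// ltW.
by move=> /(inf_lt Sinf.1)[_ [x /= yx <-] xz]; exists x; exact: ltW.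
Qed.

End critical_value_spec.

Lemma measurable_critical_value i (a : Theta i) :
  measurable_fun [set y | 0 <= y /\ exists x, y <= phi x a] (cv a).
Proof.
apply: nondecreasing_in_measurable.
  move=> x y [x0 _] [_ [t yt]] z /andP[xz zy]; split.
    exact: le_trans xz.
  by exists t; rewrite (le_trans zy).
move=> x y [x0 xt] [y0 yt] xy; rewrite leNgt; apply/negP => yx.
(* Were the critical value smaller at [y] than at [x], some type reaching [y], and hence [x], would
   have a value at most the midpoint of the two. *)
have [|t yt' tz] := critical_value_approx y0 yt (z := (cv a x + cv a y) / 2).
  by lra.
have := critical_value_le x0 xt (le_trans xy yt'); lra.
Qed.

Lemma threshold_ge0 b th i : 0 <= thr b th i.
Proof. by apply: bigmax_ge_id. Qed.

Lemma le_threshold b th i j : j != i -> phi (b j) (th j) <= thr b th i.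
Proof. by move=> ji; rewrite /threshold; apply: (bigmax_sup j). Qed.

Lemma threshold_le b th i : win b th i -> thr b th i <= phi (b i) (th i).
Proof.
move=> /andP[/ltW phi0 /forallP H]; apply/bigmax_leP; split => // j ji.
by have := H j; rewrite ji/= => /orP[/ltW//|/andP[/eqP ->]].
Qed.

Lemma wins_threshold b th i : thr b th i < phi (b i) (th i) -> win b th i.
Proof.
move=> H; apply/andP; split; first exact: le_lt_trans (threshold_ge0 _ _ _) H.
by apply/forallP => j; apply/implyP => ji; rewrite (le_lt_trans (le_threshold _ _ ji)).
Qed.

Lemma eq_threshold b b' th th' i :
  (forall j, j != i -> b j = b' j /\ th j = th' j) -> thr b th i = thr b' th' i.
Proof. by move=> E; apply: eq_bigr => j /E[-> ->]. Qed.

Lemma wins_inj b th i j : win b th i -> win b th j -> i = j.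
Proof.
move=> /andP[_ /forallP/(_ j) wi] /andP[_ /forallP/(_ i) wj].
apply/eqP; apply: contraT => ij; move: wi wj.
rewrite (eq_sym j) ij/= => /orP[ji|/andP[/eqP ji pij]] /orP[ij'|/andP[/eqP ij' pji]].
- by have := lt_trans ji ij'; rewrite ltxx.
- by move: ji; rewrite ij' ltxx.
- by move: ij'; rewrite ji ltxx.
- by have := ltn_trans pij pji; rewrite ltnn.
Qed.

(** Among the bidders of maximal virtual value, the one of least [prio] wins. *)
Lemma exists_winner b th i : 0 < phi (b i) (th i) -> exists j, win b th j.
Proof.
move=> phi0; pose k j := phi (b j) (th j).
have [i1 _ i1max] := arg_maxP k (erefl true : predT i).
have [i2 /eqP i2E i2min] := @arg_minnP _ i1 (fun j => k j == k i1)
  (fun j => prio j : nat) (eqxx _).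
exists i2; apply/andP; split.
  by rewrite -/(k i2) i2E (lt_le_trans phi0)//; exact: i1max.
apply/forallP => j; apply/implyP => ji; rewrite -/(k j) -/(k i2) i2E.
have /= := i1max j isT; rewrite le_eqVlt => /orP[jE|->//].
rewrite jE/= ltn_neqAle i2min// andbT orbC/=.
by apply/orP; left; apply: contra ji => /eqP/val_inj/perm_inj ->.
Qed.

Lemma sum_wins_le1 b th : \sum_i (win b th i)%:R <= 1 :> R.
Proof.
have [[i wi]|/forallNP no] := pselect (exists i, win b th i).
  rewrite (bigD1 i)//= wi big1 ?addr0// => j ji.
  by have [wj|//] := boolP (win b th j); rewrite (wins_inj wi wj) eqxx in ji.
by rewrite big1// => i _; have [/no|] := boolP (win b th i).
Qed.

(** All virtual values are at most the winner's, which is positive, while the shares sum to at most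
    1. If nobody wins, no virtual value is positive. *)
Lemma virtual_welfare_le b th (x : 'I_n -> R) :
  (forall i, 0 <= x i) -> \sum_i x i <= 1 ->
  \sum_i x i * phi (b i) (th i) <= \sum_i (win b th i)%:R * phi (b i) (th i).
Proof.
move=> x0 x1.
have w0 i : 0 <= (win b th i)%:R * phi (b i) (th i).
  by case: (boolP (win b th i)) => [/andP[/ltW ? _]|_]; rewrite ?mul1r ?mul0r.
have [[i wi]|/forallNP no] := pselect (exists i, win b th i).
  apply: (@le_trans _ _ (phi (b i) (th i))); last first.
    by rewrite (bigD1 i)//= wi mul1r lerDl sumr_ge0.
  have /andP[phi0 _] := wi.
  apply: (@le_trans _ _ (\sum_j x j * phi (b i) (th i))).
    apply: ler_sum => j _; rewrite ler_wpM2l//.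
    have [->//|ji] := eqVneq j i.
    exact: le_trans (le_threshold _ _ ji) (threshold_le wi).
  by rewrite -mulr_suml ler_piMl// ltW.
apply: (@le_trans _ _ 0); last exact: sumr_ge0.
apply: sumr_le0 => i _; rewrite mulr_ge0_le0//.
by rewrite leNgt; apply/negP => /exists_winner[j /no].
Qed.

Lemma myerson_pay_ge0 b th i : 0 <= myerson_pay v h f prio b th i.
Proof.
rewrite /myerson_pay; case: ifPn => // wi.
apply: critical_value_ge0; first exact: threshold_ge0.
by exists (b i); exact: threshold_le.
Qed.

Lemma myerson_utility_ge0 t th i :
  0 <= (win t th i)%:R * v (th i) (t i) - myerson_pay v h f prio t th i.
Proof.
rewrite /myerson_pay; case: ifPn => wi; last by rewrite mul0r subr0.
rewrite mul1r subr_ge0; apply: critical_value_le => //.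
- exact: threshold_ge0.
- by exists (t i); exact: threshold_le.
- exact: threshold_le.
Qed.

(** The price depends on the other bidders alone. A misreport can turn losing into winning only if
    the true virtual value is at most the threshold, and then the true value is at most the
    price. *)
Lemma myerson_truthful t th i (x : T i) :
  (win (dfwith t i x) th i)%:R * v (th i) (t i)
    - myerson_pay v h f prio (dfwith t i x) th i
  <= (win t th i)%:R * v (th i) (t i) - myerson_pay v h f prio t th i.
Proof.
have [wx|wx] := boolP (win (dfwith t i x) th i); last first.
  rewrite [X in X <= _](_ : _ = 0); first exact: myerson_utility_ge0.
  by rewrite /myerson_pay (negbTE wx) mul0r subr0.
have thrE : thr (dfwith t i x) th i = thr t th i.
  by apply: eq_threshold => j ji; rewrite dfwithout// eq_sym.
have [wt|wt] := boolP (win t th i).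
  by rewrite /myerson_pay wx wt thrE.
rewrite /myerson_pay wx (negbTE wt) mul1r mul0r subr0 subr_le0 thrE.
apply: critical_value_ge.
- exact: threshold_ge0.
- by exists x; have := threshold_le wx; rewrite thrE dfwithin.
- by rewrite leNgt; apply: contra wt; exact: wins_threshold.
Qed.

Lemma measurable_wins th i : measurable [set t | win t th i].
Proof.
have mphi j : measurable_fun setT (fun t : profile T => phi (t j) (th j)).
  exact: (measurableT_comp (measurable_virtual_value _) (@measurable_coord _ _ _ j)).
have mlt (k l : profile T -> R) : measurable_fun setT k -> measurable_fun setT l ->
    measurable [set t | k t < l t].
  by move=> mk ml; rewrite -[X in measurable X]setTI; exact: measurable_fun_ltr.
have meq (k l : profile T -> R) : measurable_fun setT k -> measurable_fun setT l ->
    measurable [set t | k t = l t].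
  move=> mk ml; rewrite (_ : mkset _ = ~` ([set t | k t < l t] `|` [set t | l t < k t])).
    by apply: measurableC; apply: measurableU; exact: mlt.
  apply/seteqP; split=> t /=; first by move=> ->; rewrite ltxx => -[].
  move=> /not_orP[/negP kl /negP lk]; apply/eqP.
  by rewrite eq_le; move: kl lk; rewrite -!leNgt => -> ->.
rewrite (_ : mkset _ = [set t | 0 < phi (t i) (th i)] `&`
    \bigcap_(j in [set j | j != i]) ([set t | phi (t j) (th j) < phi (t i) (th i)] `|`
      ([set t | phi (t j) (th j) = phi (t i) (th i)] `&` [set _ | (prio i < prio j)%N]))).
  apply: measurableI; first exact: mlt.
  apply: fin_bigcap_measurable => [|j _]; first exact: finite_finset.
  apply: measurableU; first exact: mlt.
  apply: measurableI; first exact: meq.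
  by have [p|p] := boolP (prio i < prio j)%N;
    [rewrite (_ : mkset _ = setT)|rewrite (_ : mkset _ = set0)] => //; apply/seteqP; split.
apply/seteqP; split=> t /=.
  move=> /andP[phi0 /forallP H]; split => // j /= ji.
  by have := H j; rewrite ji => /orP[|/andP[/eqP]]; [left|right].
move=> [phi0 H]; apply/andP; split => //; apply/forallP => j; apply/implyP => ji.
by have [->//|[/= -> ->]] := H j ji; rewrite eqxx orbT.
Qed.

Lemma measurable_threshold th i : measurable_fun setT (fun t => thr t th i).
Proof.
rewrite /threshold; elim: (index_enum _) => [|j s IH].
  rewrite (_ : (fun t => _) = cst 0) //.
  by apply/funext => t; rewrite big_nil.
have mphi : measurable_fun setT (fun t : profile T => phi (t j) (th j)).
  exact: (measurableT_comp (measurable_virtual_value _) (@measurable_coord _ _ _ j)).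
have [ji|ji] := boolP (j != i).
  apply: (eq_measurable_fun (fun t => Num.max (phi (t j) (th j))
    (\big[Num.max/0]_(l <- s | l != i) phi (t l) (th l)))).
    by move=> t _; rewrite big_cons ji.
  exact: measurable_maxr.
apply: (eq_measurable_fun (fun t =>
  \big[Num.max/0]_(l <- s | l != i) phi (t l) (th l))) => // t _.
by rewrite big_cons (negbTE ji).
Qed.

Lemma measurable_myerson_pay th i :
  measurable_fun setT (fun t => myerson_pay v h f prio t th i).
Proof.
rewrite (_ : (fun _ => _) = (fun t => cv (th i) (thr t th i)) \_ [set t | win t th i]).
  apply/(measurable_restrictT _ _).1; first exact: measurable_wins.
  have mt : measurable_fun [set t | win t th i] (fun t => thr t th i).
    by apply: measurable_funTS; exact: measurable_threshold.
  refine (measurable_comp _ _ (@measurable_critical_value i (th i)) mt).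
  - apply: is_interval_measurable.
    move=> x y [x0 _] [_ [t yt]] z /andP[xz zy]; split; first exact: le_trans xz.
    by exists t; rewrite (le_trans zy).
  - move=> _ [t /= wt <-]; split; first exact: threshold_ge0.
    by exists (t i); exact: threshold_le.
apply/funext => t; rewrite /myerson_pay patchE; case: ifPn => [w|/negP w].
  by rewrite mem_set.
by rewrite memNset.
Qed.

Lemma is_mechanism_SMA : is_mechanism (SMA v h f prio).
Proof.
have mdist th : measurable_fun setT
    (fun z : profile T * dist R (state_profile Theta) => z.2 th).
  exact: (measurableT_comp (measurable_dist_coord th)).
split=> /=.
- move=> b mu i; split; apply: sumr_ge0 => th _.
    by rewrite mulr_ge0 ?dist_ge0.
  by rewrite mulr_ge0 ?dist_ge0// myerson_pay_ge0.
- move=> b mu; rewrite exchange_big/= -[leRHS](dist_sum1 mu); apply: ler_sum => th _.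
  by rewrite -mulr_sumr ler_piMr ?dist_ge0// sum_wins_le1.
- move=> i; apply: measurable_sum => th; apply: measurable_funM => //.
  apply: (@measurableT_comp _ _ _ _ _ _ (fun t => (win t th i)%:R : R)) => //.
  rewrite (_ : (fun t => _) = \1_[set t | win t th i]).
    by apply: measurable_indic; exact: measurable_wins.
  apply/funext => t; rewrite indicE; congr ((nat_of_bool _)%:R).
  by apply/idP/idP => [/mem_set//|/set_mem].
- move=> i; apply: measurable_sum => th; apply: measurable_funM => //.
  exact: (measurableT_comp (measurable_myerson_pay th i)).
Qed.

End critical_values.

(** Symmetrisation: the double sum of [p x * p y * ((k x - k y) * (l x - l y))] is twice the
    difference of the two sides. Common monotonicity is asked only on the support of [p], which for
    a posterior consists of states the signals allow. *)
Lemma chebyshev_sum (R : realFieldType) (X : finType) (p k l : X -> R) :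
  (forall x, 0 <= p x) -> \sum_x p x = 1 ->
  (forall x y, 0 < p x -> 0 < p y -> 0 <= (k x - k y) * (l x - l y)) ->
  (\sum_x p x * k x) * (\sum_x p x * l x) <= \sum_x p x * (k x * l x).
Proof.
move=> p0 p1 kl.
have : 0 <= \sum_x \sum_y p x * p y * ((k x - k y) * (l x - l y)).
  apply: sumr_ge0 => x _; apply: sumr_ge0 => y _.
  have [px|px] := eqVneq (p x) 0; first by rewrite px !mul0r.
  have [py|py] := eqVneq (p y) 0; first by rewrite py mulr0 mul0r.
  by apply: mulr_ge0; [exact: mulr_ge0|apply: kl]; rewrite lt_neqAle eq_sym ?px ?py p0.
set K := \sum_x p x * k x; set L := \sum_x p x * l x.
set M := \sum_x p x * (k x * l x).
suff -> : \sum_x \sum_y p x * p y * ((k x - k y) * (l x - l y)) =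
    M + M - (K * L + K * L) by lra.
transitivity (\sum_x (p x * (k x * l x) + p x * M
    - (p x * k x * L + p x * l x * K))).
  apply: eq_bigr => x _.
  transitivity (\sum_y (p x * (k x * l x) * p y + p x * (p y * (k y * l y))
      - (p x * k x * (p y * l y) + p x * l x * (p y * k y)))).
    by apply: eq_bigr => y _; ring.
  by rewrite sumrB !big_split/= -!mulr_sumr p1 mulr1.
rewrite sumrB !big_split/= -!mulr_suml p1 mul1r.
by rewrite -/M -/K -/L [L * K]mulrC.
Qed.

(** * Truthfulness *)

Section truthfulness.
Context {R : realType} {n : nat} {d : 'I_n -> measure_display}
  {T : forall i, measurableType (d i)} {Theta : 'I_n -> pfinType}.
Variables (v : forall i, Theta i -> {mfun T i >-> R})
  (g : dist R (state_profile Theta))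
  (h : forall i, probability (T i) R)
  (tau : forall i, probability (dist R (Theta i)) R)
  (f : forall i, Theta i -> R -> R) (prio : {perm 'I_n}).
Local Notation phi := (virtual_value v h f).
Local Notation win := (wins v h f prio).
Local Notation mechanism_pay := Defs.pay.
Local Notation pay := (myerson_pay v h f prio).
Local Notation D := (state_signal_density g).
Local Notation M := (SMA v h f prio).
Hypothesis tau_experiment : forall i, is_experiment g (tau i).
Hypothesis f_density : is_value_density v h f.
Hypothesis info_sufficient : information_sufficient v h f prio tau.
Hypothesis reg_values : regular_values v.
Hypothesis reg_virtual : regular_virtual_values v h f.
Implicit Types (b t : profile T) (th : state_profile Theta)
  (s : signal_profile R Theta).

Lemma with_state_same th i (a : Theta i) : with_state th a i = a.
Proof. by rewrite ffunE dfwithin. Qed.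

Lemma with_state_other th i (a : Theta i) j : j != i -> with_state th a j = th j.
Proof. by move=> ji; rewrite ffunE dfwithout// eq_sym. Qed.

Lemma with_state_id th i : with_state th (th i) = th.
Proof.
apply/ffunP => j; have [->|ji] := eqVneq j i; first exact: with_state_same.
exact: with_state_other.
Qed.

Lemma wins_own_state t i (s : dist R (Theta i)) th (a a' : Theta i) :
  outcome (tau i) s -> 0 < s a -> 0 < s a' ->
  win t (with_state th a) i = win t (with_state th a') i.
Proof.
move=> os sa sa'.
have V := info_sufficient t os th.
pose F (a : Theta i) := (win t (with_state th a) i)%:R : R.
set m := \sum_y s y * F y.
have FE c : 0 < s c -> F c = m.
  move=> sc.
  have : s c * (F c - m) ^+ 2 = 0.
    apply/eqP; move/eqP: V; rewrite /dist_variance psumr_eq0; last first.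
      by move=> x _; rewrite mulr_ge0 ?dist_ge0 ?sqr_ge0.
    by move=> /allP/(_ c (mem_index_enum _)).
  by move=> /eqP; rewrite mulf_eq0 gt_eqF//= sqrf_eq0 subr_eq0 => /eqP.
have : F a = F a' by rewrite !FE.
by rewrite /F; case: (win _ _ i); case: (win _ _ i) => // /eqP;
  rewrite ?oner_eq0// eq_sym oner_eq0.
Qed.

(** Bidder [j] keeps the same status by information sufficiency. If [i] is another bidder, the
    winner after the change is not [j], and the comparison between that winner and [i] involves two
    unchanged virtual values. *)
Lemma wins_coordinate t s th j (a : Theta j) i :
  (forall k, outcome (tau k) (s k)) -> (forall k, 0 < s k (th k)) -> 0 < s j a ->
  win t th i -> win t (with_state th a) i.
Proof.
move=> os sth sa wi.
have wj : win t (with_state th a) j = win t th j.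
  by rewrite -[in RHS](with_state_id th j); exact: wins_own_state (os j) _ _.
have [ij|ij] := eqVneq i j; first by rewrite ij wj -ij.
have phi0 : 0 < phi (t i) (with_state th a i).
  by rewrite with_state_other//; case/andP: wi.
have [k wk] := exists_winner prio phi0.
have kj : k != j.
  apply: contraNneq ij => kj; subst k; apply/eqP.
  by rewrite wj in wk; exact: wins_inj wi wk.
have [->//|ki] := eqVneq i k.
exfalso; move/eqP: ki; apply.
have wk' := wk; move: wk => /andP[_ /forallP/(_ i)].
move: wi => /andP[_ /forallP/(_ k)].
rewrite !with_state_other//.
have [->//|ik] := eqVneq i k; rewrite /=.
move=> /orP[ki|/andP[/eqP ki pik]] /orP[ik'|/andP[/eqP ik' pki]].
- by have := lt_trans ki ik'; rewrite ltxx.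
- by move: ki; rewrite ik' ltxx.
- by move: ik'; rewrite ki ltxx.
- by have := ltn_trans pik pki; rewrite ltnn.
Qed.

(* By information sufficiency no bidder's winning status reacts to the own
   state, so replacing one coordinate at a time keeps the winner. *)
Lemma wins_constant t s th th' i :
  (forall k, outcome (tau k) (s k)) ->
  (forall k, 0 < s k (th k)) -> (forall k, 0 < s k (th' k)) ->
  win t th i = win t th' i.
Proof.
move=> os.
suff H th1 th2 : (forall k, 0 < s k (th1 k)) -> (forall k, 0 < s k (th2 k)) ->
    win t th1 i -> win t th2 i.
  by move=> s1 s2; apply/idP/idP; exact: H.
move=> s1 s2 w1.
pose mix m : state_profile Theta := [ffun k : 'I_n => if (k < m)%N then th2 k else th1 k].
have smix m k : 0 < s k (mix m k) by rewrite ffunE; case: ifP.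
have wmix m : (m <= n)%N -> win t (mix m) i.
  elim: m => [_|m IH mn]; first by rewrite (_ : mix 0%N = th1)//;
    apply/ffunP => k; rewrite ffunE.
  rewrite (_ : mix m.+1 = with_state (mix m) (th2 (Ordinal mn))).
    by apply: wins_coordinate os (smix m) _ (IH (ltnW mn)).
  apply/ffunP => k; have [->|km] := eqVneq k (Ordinal mn).
    by rewrite with_state_same ffunE /= ltnSn.
  rewrite with_state_other// !ffunE ltnS leq_eqVlt.
  by have -> : (k == m :> nat) = false by apply/negbTE.
rewrite (_ : th2 = mix n); first exact: wmix.
by apply/ffunP => k; rewrite ffunE ltn_ord.
Qed.

(** Otherwise almost every belief gives [a] weight 0, and so does their mean, which is the
    marginal. *)
Lemma outcome_support i (a : Theta i) : 0 < marginal g a ->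
  exists2 s, outcome (tau i) s & 0 < s a.
Proof.
move=> ga; apply: contrapT => /forall2NP H.
have : (\int[tau i]_s (s a)%:E = 0)%E.
  rewrite -(integral0 (tau i) setT); apply: ge0_ae_eq_integral => //.
  - by apply/measurable_EFinP; exact: measurable_dist_coord.
  - by move=> s _; rewrite lee_fin dist_ge0.
  have := ae_outcome (tau i); apply: filterS => s os _.
  have [//|/negP] := H s; rewrite -leNgt => sa.
  by congr EFin; apply/eqP; rewrite eq_le sa dist_ge0.
rewrite tau_experiment => -[ga0]; by rewrite ga0 ltxx in ga.
Qed.

Lemma posterior_mean s (k : state_profile Theta -> R) :
  signal_density g s * (\sum_th posterior g s th * k th) = \sum_th D th s * k th.
Proof.
by rewrite mulr_sumr; apply: eq_bigr => th _; rewrite mulrA signal_densityM.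
Qed.

Local Notation ustar := (fun t i th =>
  (win t th i)%:R * v (th i) (t i) - pay t th i).

Lemma truthful_utility t s i : (forall k, outcome (tau k) (s k)) ->
  0 < signal_density g s ->
  utility v M (t i) t (posterior g s) = \sum_th posterior g s th * ustar t i th.
Proof.
move=> os s0; set mu := posterior g s.
have mu0 th : 0 <= mu th by exact: dist_ge0.
have supp th : 0 < mu th -> forall k, 0 < s k (th k).
  by move=> p0; have [] := posterior_support s0 p0.
(* A reference state of positive posterior weight: the status there is the status wherever the
   posterior has mass, so the winning factor leaves the sum. *)
have [th0 th0s] : exists th0, 0 < mu th0.
  apply: contrapT => /forallNP H.
  have : \sum_th mu th = 0.
    by apply: big1 => th _; apply/eqP; rewrite eq_le mu0 leNgt andbT; exact/negP.
  by rewrite dist_sum1 => /eqP; rewrite oner_eq0.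
have winE th : mu th * (win t th i)%:R = mu th * (win t th0 i)%:R.
  have [->|p0] := eqVneq (mu th) 0; first by rewrite !mul0r.
  congr (_ * (nat_of_bool _)%:R); apply: wins_constant os (supp _ _) (supp _ th0s).
  by rewrite lt_neqAle eq_sym p0 mu0.
rewrite /utility /post_value /=; under [in RHS]eq_bigr do rewrite mulrBr mulrA winE.
rewrite sumrB; congr (_ - _); under eq_bigr do rewrite winE.
rewrite -mulr_suml dist_sum1 mul1r mulr_sumr.
by apply: eq_bigr => th _; rewrite mulrA [_ * mu th]mulrC.
Qed.

Lemma wins_own_mono b th i (a : Theta i) :
  phi (b i) (th i) <= phi (b i) a -> win b th i -> win b (with_state th a) i.
Proof.
move=> tha /andP[phi0 /forallP H]; rewrite /wins with_state_same.
rewrite (lt_le_trans phi0 tha)/=; apply/forallP => j; apply/implyP => ji.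
have := H j; rewrite ji/= with_state_other// => /orP[jlt|/andP[/eqP -> ->]].
  by rewrite (lt_le_trans jlt tha).
by rewrite andbT orbC -le_eqVlt.
Qed.

Lemma deviation_utility i t (x : T i) s :
  (forall k, k != i -> outcome (tau k) (s k)) -> 0 < signal_density g s ->
  utility v M (t i) (dfwith t i x) (posterior g s) <=
  \sum_th posterior g s th * ustar t i th.
Proof.
move=> os s0; set mu := posterior g s; set b := dfwith t i x.
have mu0 th : 0 <= mu th by exact: dist_ge0.
have mono th1 th2 : 0 < mu th1 -> 0 < mu th2 ->
    v (th2 i) (t i) <= v (th1 i) (t i) -> win b th2 i -> win b th1 i.
  move=> m1 m2 v21 w2.
  have [g1 s1] := posterior_support s0 m1; have [g2 s2] := posterior_support s0 m2.
  have [si osi si1] := outcome_support (marginal_gt0 i g1).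
  (* Bidder [i] may have garbled, so [s i] is replaced by an outcome supporting [th1 i]. Both [th1]
     and [th2] with own state [th1 i] are allowed by [s'] and share their winner; it remains to
     raise the own state. *)
  pose s' : signal_profile R Theta := dfwith s i si.
  have os' k : outcome (tau k) (s' k).
    have [<-|ik] := eqVneq i k; first by rewrite /s' dfwithin.
    by rewrite /s' dfwithout//; apply: os; rewrite eq_sym.
  rewrite (@wins_constant b s' th1 (with_state th2 (th1 i)) i)//.
  - apply: wins_own_mono => //; rewrite le_virtual_value//.
    by rewrite (reg_values _ _ _ (t i)).
  - move=> k; have [<-|ik] := eqVneq i k; first by rewrite /s' dfwithin.
    by rewrite /s' dfwithout.
  - move=> k; have [<-|ik] := eqVneq i k; first by rewrite /s' dfwithin with_state_same.
    by rewrite /s' dfwithout// with_state_other// eq_sym.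
(* The middle term is the utility if each state were known when the misreport is judged:
   [chebyshev_sum] gets there, [myerson_truthful] goes on. *)
apply: (@le_trans _ _ (\sum_th mu th *
    ((win b th i)%:R * v (th i) (t i) - pay b th i))); last first.
  by apply: ler_sum => th _; rewrite ler_wpM2l// myerson_truthful.
under [leRHS]eq_bigr do rewrite mulrBr.
rewrite sumrB /utility /post_value/= lerD2r; apply: chebyshev_sum => //.
  exact: dist_sum1.
move=> th1 th2 m1 m2; have := mono _ _ m1 m2; have := mono _ _ m2 m1.
case: (win b th1 i); case: (win b th2 i) => /= H1 H2.
- by rewrite subrr mul0r.
- rewrite subr0 mul1r subr_ge0 leNgt; apply/negP => /ltW /H1 /(_ isT); by [].
- rewrite sub0r mulN1r oppr_ge0 subr_le0 leNgt; apply/negP => /ltW /H2 /(_ isT); by [].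
- by rewrite subrr mul0r.
Qed.

Lemma expost_IR_SMA : expost_IR v g tau M.
Proof.
move=> i t s [os s0]; rewrite truthful_utility//; apply: sumr_ge0 => th _.
by rewrite mulr_ge0 ?dist_ge0// myerson_utility_ge0.
Qed.

(** The law of the state is [g] under any experiments, so truth-telling and deviating are measured
    against the same benchmark. *)
Lemma expect_state lam (k : state_profile Theta -> R) :
  (forall i, is_experiment g (lam i)) -> (forall th, 0 <= k th) ->
  (\int[prod_probability lam]_s (\sum_th D th s * k th)%:E
   = (\sum_th g th * k th)%:E)%E.
Proof.
move=> lamE k0; under eq_integral do rewrite -sumEFin.
rewrite ge0_integral_sum//; last 2 first.
- move=> th; apply/measurable_EFinP; apply: measurable_funM => //.
  exact: measurable_state_signal_density.
- by move=> th s _; rewrite lee_fin mulr_ge0// state_signal_density_ge0.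
rewrite -sumEFin; apply: eq_bigr => th _; under eq_integral do rewrite EFinM.
rewrite ge0_integralZr ?integral_state_signal_density ?lee_fin//.
- by apply/measurable_EFinP; exact: measurable_state_signal_density.
- by move=> s _; rewrite lee_fin state_signal_density_ge0.
Qed.

Lemma measurable_alloc_posterior (M' : mechanism R T Theta) i : is_mechanism M' ->
  measurable_fun setT (fun z : signal_profile R Theta * profile T =>
    alloc M' z.2 (posterior g z.1) i).
Proof.
move=> [_ _ mx _]; have mz : measurable_fun setT
    (fun z : signal_profile R Theta * profile T => (z.2, posterior g z.1)).
  apply: measurable_fun_pair => //.
  exact: (measurableT_comp (measurable_posterior g)).
exact: (measurableT_comp (mx i) mz).
Qed.

Lemma measurable_pay_posterior (M' : mechanism R T Theta) i : is_mechanism M' ->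
  measurable_fun setT (fun z : signal_profile R Theta * profile T =>
    mechanism_pay M' z.2 (posterior g z.1) i).
Proof.
move=> [_ _ _ mp]; have mz : measurable_fun setT
    (fun z : signal_profile R Theta * profile T => (z.2, posterior g z.1)).
  apply: measurable_fun_pair => //.
  exact: (measurableT_comp (measurable_posterior g)).
exact: (measurableT_comp (mp i) mz).
Qed.

Lemma measurable_utility (M' : mechanism R T Theta) i (x : T i) b :
  is_mechanism M' ->
  measurable_fun setT (fun s : signal_profile R Theta =>
    ((signal_density g s)%:E * (utility v M' x b (posterior g s))%:E)%E).
Proof.
move=> mM; have mb : measurable_fun setT
  (fun s : signal_profile R Theta => (s, b)) by exact: measurable_fun_pair.
apply: emeasurable_funM; apply/measurable_EFinP; first exact: measurable_signal_density.
apply: measurable_funB.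
  apply: measurable_funM.
    exact: (measurableT_comp (measurable_alloc_posterior i mM) mb).
  apply: measurable_sum => th; apply: measurable_funM => //.
  exact: (measurableT_comp (measurable_dist_coord th) (measurable_posterior g)).
exact: (measurableT_comp (measurable_pay_posterior i mM) mb).
Qed.

Lemma expost_IIC_SMA : expost_IIC v g tau M.
Proof.
move=> i t x lam tau_lam; have mM : is_mechanism M by exact: is_mechanism_SMA.
have lamE j : is_experiment g (dfwith tau i lam j).
  by case: dfwithP => // *; exact: MPS_experiment tau_lam.
have mu th : 0 <= ustar t i th by exact: myerson_utility_ge0.
have mD : measurable_fun setT (fun s : signal_profile R Theta =>
    (\sum_th D th s * ustar t i th)%:E).
  apply/measurable_EFinP; apply: measurable_sum => th; apply: measurable_funM => //.
  exact: measurable_state_signal_density.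
rewrite /expected_utility /expect_signals.
rewrite [leRHS](_ : _ = (\sum_th g th * ustar t i th)%:E); last first.
  rewrite -(expect_state tau_experiment)//; apply: ae_eq_integral => //.
    exact: measurable_utility.
  have : {ae prod_probability tau, forall s, forall k, outcome (tau k) (s k)}.
    by apply: filter_forall => k; apply: ae_coord; exact: ae_outcome.
  apply: ae_imply => s os _; rewrite -EFinM; congr EFin.
  have := signal_density_ge0 g s; rewrite le_eqVlt => /predU1P[s0|s0].
    by rewrite -posterior_mean -s0 !mul0r.
  by rewrite truthful_utility// posterior_mean.
pose F s := ((signal_density g s)%:E *
  (utility v M (t i) (dfwith t i x) (posterior g s))%:E)%E.
have mF : measurable_fun setT F by exact: measurable_utility.
rewrite -(expect_state lamE)// -[leLHS]/(\int[prod_probability (dfwith tau i lam)]_s F s)%E.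
(* The deviator's utility has no sign; its integral is at most that of the positive part, which the
   nonnegative benchmark dominates. *)
rewrite integralE.
apply: (@le_trans _ _ (\int[prod_probability (dfwith tau i lam)]_s F^\+ s)%E).
  by rewrite -[leRHS]sube0; apply: leeB => //; exact: integral_ge0.
apply: ae_ge0_le_integral => //.
- exact: measurable_funepos.
- move=> s _; rewrite lee_fin; apply: sumr_ge0 => th _.
  by rewrite mulr_ge0// state_signal_density_ge0.
(* Bidder [i] draws from [lam], so only the opponents' signals are almost surely outcomes. *)
have : {ae prod_probability (dfwith tau i lam), forall s : signal_profile R Theta,
    forall k, k != i -> outcome (tau k) (s k)}.
  apply: filter_forall => k; have [->|ki] := eqVneq k i; first exact: nearW.
  have H : {ae dfwith tau i lam k, forall s' : dist R (Theta k), outcome (tau k) s'}.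
    by rewrite dfwithout// 1?eq_sym//; exact: ae_outcome.
  by apply: ae_imply (ae_coord H) => s os _; exact: os.
apply: ae_imply => s os _; rewrite funeposE ge_max; apply/andP; split.
  rewrite /F -EFinM lee_fin.
  have := signal_density_ge0 g s; rewrite le_eqVlt => /predU1P[s0|s0].
    by rewrite -posterior_mean -s0 !mul0r.
  by rewrite -posterior_mean ler_wpM2l ?signal_density_ge0// deviation_utility.
rewrite lee_fin; apply: sumr_ge0 => th _.
by rewrite mulr_ge0// state_signal_density_ge0.
Qed.

End truthfulness.

(** * Revenue of the threshold payments in a fixed state *)

Section simulated_revenue.
Context {R : realType} {n : nat} {d : 'I_n -> measure_display}
  {T : forall i, measurableType (d i)} {Theta : 'I_n -> pfinType}.
Variables (v : forall i, Theta i -> {mfun T i >-> R})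
  (h : forall i, probability (T i) R)
  (f : forall i, Theta i -> R -> R) (prio : {perm 'I_n}).
Local Notation phi := (virtual_value v h f).
Local Notation win := (wins v h f prio).
Local Notation pay := (myerson_pay v h f prio).
Hypothesis f_density : is_value_density v h f.
Hypothesis vhf_myerson : myerson_setting v h f.
Hypothesis reg_virtual : regular_virtual_values v h f.
Local Notation PT := (prod_probability h).

Lemma wins_virtual_ge0 t (th : state_profile Theta) i :
  0 <= (win t th i)%:R * phi (t i) (th i).
Proof.
by case: (boolP (win t th i)) => [/andP[/ltW ? _]|_]; rewrite ?mul1r ?mul0r.
Qed.

Lemma measurable_wins_indic (th : state_profile Theta) i :
  measurable_fun setT (fun t : profile T => (win t th i)%:R : R).
Proof.
rewrite (_ : (fun t => _) = \1_[set t | win t th i]).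
  by apply: measurable_indic; exact: measurable_wins.
apply/funext => t; rewrite indicE; congr ((nat_of_bool _)%:R).
by apply/idP/idP => [/mem_set//|/set_mem].
Qed.

Lemma measurable_wins_virtual (th : state_profile Theta) i :
  measurable_fun setT (fun t : profile T => (win t th i)%:R * phi (t i) (th i)).
Proof.
apply: measurable_funM; first exact: measurable_wins_indic.
exact: (measurableT_comp (measurable_virtual_value f_density _) (@measurable_coord _ _ _ i)).
Qed.

(** For fixed opponents the bidder faces the posted price [r], the critical value at the threshold,
    and wins above it; resampling the own type reduces the claim to [integral_virtual_le]. *)
Lemma wins_virtual_revenue (th : state_profile Theta) i :
  (\int[PT]_t ((win t th i)%:R * phi (t i) (th i))%:E
   <= \int[PT]_t (pay t th i)%:E)%E.
Proof.
have mpay := measurable_myerson_pay prio f_density reg_virtual th i.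
have pay0 t : 0 <= pay t th i by exact: myerson_pay_ge0.
have mpay' : measurable_fun setT (fun t : profile T => (pay t th i)%:E).
  exact/measurable_EFinP.
have mwin : measurable_fun setT
    (fun t : profile T => ((win t th i)%:R * phi (t i) (th i))%:E).
  by apply/measurable_EFinP; exact: measurable_wins_virtual.
rewrite (ge0_integral_resample h i); last 2 first.
- by apply/measurable_EFinP; exact: measurable_wins_virtual.
- by move=> t; rewrite lee_fin wins_virtual_ge0.
rewrite [leRHS](ge0_integral_resample h i); last 2 first.
- exact/measurable_EFinP.
- by move=> t; rewrite lee_fin.
apply: ge0_le_integral => //.
- by move=> t _; apply: integral_ge0 => b _; rewrite lee_fin wins_virtual_ge0.
- apply: (@measurable_integral_dfwith _ _ _ _ h i (fun t => ((win t th i)%:R * phi (t i) (th i))%:E)).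
    by apply/measurable_EFinP; exact: measurable_wins_virtual.
  by move=> t; rewrite lee_fin wins_virtual_ge0.
- apply: (@measurable_integral_dfwith _ _ _ _ h i (fun t => (pay t th i)%:E)); first exact/measurable_EFinP.
  by move=> t; rewrite lee_fin.
move=> t _; set a := th i; set y := threshold v h f t th i.
have yE b : threshold v h f (dfwith t i b) th i = y.
  by apply: eq_threshold => j ji; rewrite dfwithout// eq_sym.
have y0 : 0 <= y by exact: threshold_ge0.
have [[b0 wb0]|/forallNP nw] := pselect (exists b, win (dfwith t i b) th i); last first.
  rewrite integral0_eq; first by apply: integral_ge0 => b _; rewrite lee_fin.
  by move=> b _; have /negP/negbTE -> := nw b; rewrite mul0r.
have yb0 : exists b : T i, y <= phi b a.
  by exists b0; have := threshold_le wb0; rewrite yE dfwithin.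
set r := critical_value v h f a y.
have r0 : 0 <= r by exact: critical_value_ge0.
have vr b : r < v a b -> y < phi b a.
  by apply: contraTT; rewrite -!leNgt; exact: critical_value_ge.
have mr : measurable [set b | r < v a b].
  rewrite (_ : mkset _ = v a @^-1` `]r, +oo[).
    exact: (@measurable_funPTI _ _ _ _ (v a)).
  by apply/seteqP; split=> b; rewrite /= in_itv/= andbT.
have [mf f0 vE] := f_density a.
have [iv itv fv _] := vhf_myerson.
apply: (@le_trans _ _ (\int[h i]_(b in [set b | (r < v a b)%R]) (phi b a)%:E)%E).
  rewrite [leRHS]integral_mkcond; apply: ae_ge0_le_integral => //.
  - by move=> b _; rewrite lee_fin wins_virtual_ge0.
  - exact: (measurableT_comp mwin (@measurable_dfwith_own _ _ _ t i)).
  - move=> b _; rewrite patchE; case: ifPn => // /set_mem/= /vr yb.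
    by rewrite lee_fin (le_trans y0)// ltW.
  - apply/(measurable_restrictT _ _).1 => //; apply: measurable_funTS.
    by apply/measurable_EFinP; exact: measurable_virtual_value.
  (* Outside this null event, a winner has a value strictly above [r]. *)
  have : (h i).-negligible [set b | v a b = r].
    apply/negligibleP; first exact: (@measurable_funPTI _ _ _ _ (v a) [set r]).
    exact: (rv_eq0 mf vE).
  apply: negligibleS => b /= /not_implyP[_ H]; apply: contrapT => vbr; apply: H.
  rewrite patchE; have [wb|wb] := boolP (win (dfwith t i b) th i).
    rewrite mem_set ?mul1r ?dfwithin//= lt_neqAle eq_sym.
    have := threshold_le wb; rewrite yE dfwithin => yb.
    by rewrite critical_value_le// andbT; apply/eqP.
  rewrite mul0r; case: ifPn => // /set_mem/= /vr yb.
  by rewrite lee_fin (le_trans y0)// ltW.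
apply: (@le_trans _ _ (r%:E * h i [set b | (r < v a b)%R])%E).
  apply: (integral_virtual_le (P := h i) (X := v a) mf f0 vE (itv i a) (fv i a)) => //.
  - by move=> z rz; have [b _ bz] := critical_value_approx f_density y0 yb0 rz;
      exists b.
  - by move=> b /vr yb; rewrite -virtual_valueE (le_trans y0)// ltW.
rewrite -(integral_cst _ mr) integral_mkcond; apply: ge0_le_integral => //.
- by move=> b _; rewrite patchE; case: ifPn => // _; rewrite lee_fin.
- by apply/(measurable_restrictT _ _).1.
- exact: (measurableT_comp mpay' (@measurable_dfwith_own _ _ _ t i)).
move=> b _; rewrite patchE; case: ifPn => [/set_mem/= /vr yb|_]; last by rewrite lee_fin.
rewrite lee_fin /myerson_pay yE wins_threshold// yE dfwithin//.
Qed.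

End simulated_revenue.

(** * Optimality *)

Section optimality.
Context {R : realType} {n : nat} {d : 'I_n -> measure_display}
  {T : forall i, measurableType (d i)} {Theta : 'I_n -> pfinType}.
Variables (v : forall i, Theta i -> {mfun T i >-> R})
  (g : dist R (state_profile Theta))
  (h : forall i, probability (T i) R)
  (tau : forall i, probability (dist R (Theta i)) R)
  (f : forall i, Theta i -> R -> R).
Hypothesis tau_experiment : forall i, is_experiment g (tau i).
Hypothesis f_density : is_value_density v h f.
Hypothesis vhf_myerson : myerson_setting v h f.
Local Notation PT := (prod_probability h).
Local Notation PS := (prod_probability tau).
Local Notation D := (state_signal_density g).
Local Notation rho t th i := (hazard_inv (v (th i) : {RV (h i) >-> R}) (f (th i)) (t i)).
Implicit Types (t : profile T) (th : state_profile Theta)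
  (s : signal_profile R Theta).

Variable M : mechanism R T Theta.
Hypotheses (mM : is_mechanism M) (IIC : expost_IIC v g tau M)
  (IR : expost_IR v g tau M).

(** [p] and [u] contain the signal density whereas [x] does not, because [x] always occurs
    multiplied by some [D th s]. *)
Let x i t s := alloc M t (posterior g s) i.
Let p i t s := signal_density g s * pay M t (posterior g s) i.
Let u i t s := signal_density g s * utility v M (t i) t (posterior g s).

Let x0 i t s : 0 <= x i t s. Proof. by case: mM => /(_ t (posterior g s) i)[]. Qed.

Let sum_x_le1 t s : \sum_i x i t s <= 1.
Proof. by case: mM => _ /(_ t (posterior g s)). Qed.

Let x1 i t s : x i t s <= 1.
Proof.
rewrite (le_trans _ (sum_x_le1 t s))// (bigD1 i)//= lerDl.
by apply: sumr_ge0 => j _; exact: x0.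
Qed.

Let p0 i t s : 0 <= p i t s.
Proof.
rewrite mulr_ge0 ?signal_density_ge0//.
by case: mM => /(_ t (posterior g s) i)[].
Qed.

Let D0 th s : 0 <= D th s. Proof. exact: state_signal_density_ge0. Qed.

Let uE i t s : u i t s = \sum_th D th s * x i t s * v (th i) (t i) - p i t s.
Proof.
rewrite /u /utility mulrBr mulrCA /post_value posterior_mean mulr_sumr.
by congr (_ - _); apply: eq_bigr => th _; rewrite -/(x i t s); ring.
Qed.

(** The null set is uniform in the types, as individual rationality covers all type profiles at a
    given revealed signal profile; this is what extends it to the product space. *)
Let revealed_ae : {ae PS, forall s, forall i t, 0 <= u i t s}.
Proof.
have : {ae PS, forall s, forall k, outcome (tau k) (s k)}.
  by apply: filter_forall => k; apply: ae_coord; exact: ae_outcome.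
apply: ae_imply => s os i t.
have := signal_density_ge0 g s; rewrite /u le_eqVlt => /predU1P[<-|s0].
  by rewrite mul0r.
by rewrite mulr_ge0 ?signal_density_ge0// IR.
Qed.

Let u_le i t s : u i t s <= \sum_th D th s * `|v (th i) (t i)|.
Proof.
rewrite uE lerBlDr (le_trans _ (_ : \sum_th D th s * `|v (th i) (t i)| <= _))//; last first.
  by rewrite lerDl.
apply: ler_sum => th _; rewrite -mulrA ler_wpM2l//.
rewrite (le_trans (ler_norm _))// normrM ger0_norm//.
by rewrite ler_piMl.
Qed.

Let mD2 th : measurable_fun setT (fun z : signal_profile R Theta * profile T => D th z.1).
Proof. exact: (measurableT_comp (measurable_state_signal_density g th)). Qed.

Let mx i : measurable_fun setT (fun z : signal_profile R Theta * profile T => x i z.2 z.1).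
Proof. exact: measurable_alloc_posterior. Qed.

Let mp i : measurable_fun setT (fun z : signal_profile R Theta * profile T => p i z.2 z.1).
Proof.
apply: measurable_funM; last exact: measurable_pay_posterior.
exact: (measurableT_comp (measurable_signal_density g)).
Qed.

Let mv i th : measurable_fun setT
  (fun z : signal_profile R Theta * profile T => v (th i) (z.2 i)).
Proof.
apply: (measurableT_comp (f := v (th i))) => //.
exact: (measurableT_comp (@measurable_coord _ _ _ i)).
Qed.

Let mu_ i : measurable_fun setT (fun z : signal_profile R Theta * profile T => u i z.2 z.1).
Proof.
apply: (eq_measurable_fun (fun z : signal_profile R Theta * profile T =>
  \sum_th D th z.1 * x i z.2 z.1 * v (th i) (z.2 i) - p i z.2 z.1)).
  by move=> z _; rewrite uE.
apply: measurable_funB => //; apply: measurable_sum => th.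
by apply: measurable_funM => //; exact: measurable_funM.
Qed.

(** Equal to [u] at almost every signal profile, and nonnegative everywhere, as Tonelli requires. *)
Let up i t s := Num.max 0 (u i t s).

Let up0 i t s : 0 <= up i t s. Proof. by rewrite /up le_max lexx. Qed.

Let mup i : measurable_fun setT (fun z : signal_profile R Theta * profile T => up i z.2 z.1).
Proof. by apply: measurable_maxr. Qed.

Let up_le i t s : up i t s <= \sum_th D th s * `|v (th i) (t i)|.
Proof. by rewrite /up ge_max u_le sumr_ge0// => th _; rewrite mulr_ge0. Qed.

Let mS (k : signal_profile R Theta * profile T -> R) t : measurable_fun setT k ->
  measurable_fun setT (fun s => k (s, t)).
Proof.
move=> mk; have mt : measurable_fun setT (fun s : signal_profile R Theta => (s, t)).
  exact: measurable_fun_pair.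
exact: (measurableT_comp mk mt).
Qed.

(** Expected allocation of bidder [i] at reports [t] on the event that the state profile is [th]. *)
Let B i th t : R := fine (\int[PS]_s (D th s * x i t s)%:E)%E.

Let integrable_Dx i th t : PS.-integrable setT (fun s => (D th s * x i t s)%:E).
Proof.
apply: (@le_integrable _ _ _ _ _ measurableT _ (fun s => (D th s)%:E)).
- apply/measurable_EFinP; apply: measurable_funM.
    exact: measurable_state_signal_density.
  exact: (mS t (mx i)).
- by move=> s _; rewrite lee_fin (ger0_norm (mulr_ge0 _ _))// (ger0_norm (D0 _ _)) ler_piMr.
apply/integrableP; split.
  by apply/measurable_EFinP; exact: measurable_state_signal_density.
under eq_integral do rewrite gee0_abs ?lee_fin//.
by rewrite integral_state_signal_density// ltry.
Qed.

Let BE i th t : (\int[PS]_s (D th s * x i t s)%:E = (B i th t)%:E)%E.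
Proof. by rewrite fineK//; apply: integrable_fin_num => //; exact: integrable_Dx. Qed.

Let B0 i th t : 0 <= B i th t.
Proof.
by rewrite -lee_fin -BE; apply: integral_ge0 => s _; rewrite lee_fin mulr_ge0.
Qed.

Let mB i th : measurable_fun setT (B i th).
Proof.
apply: (measurableT_comp (f := fine)) => //.
apply: (@measurable_fun_fubini_tonelli_G _ _ _ _ _ PS
  (fun z : signal_profile R Theta * profile T => (D th z.1 * x i z.2 z.1)%:E)).
  by apply/measurable_EFinP; exact: measurable_funM.
by move=> z; rewrite lee_fin mulr_ge0.
Qed.

Let U i t : R := fine (\int[PS]_s (up i t s)%:E)%E.

Let integrable_up i t : PS.-integrable setT (fun s => (up i t s)%:E).
Proof.
apply: (@le_integrable _ _ _ _ _ measurableT _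
  (fun s => (\sum_th D th s * `|v (th i) (t i)|)%:E)).
- by apply/measurable_EFinP; exact: (mS t (mup i)).
- move=> s _; rewrite lee_fin !ger0_norm//; apply: sumr_ge0 => th _.
  by rewrite mulr_ge0.
apply/integrableP; split.
  apply/measurable_EFinP; apply: measurable_sum => th; apply: measurable_funM => //.
  exact: measurable_state_signal_density.
under eq_integral => s _.
  rewrite gee0_abs ?lee_fin; last by apply: sumr_ge0 => th _; rewrite mulr_ge0.
  over.
by rewrite expect_state// ltry.
Qed.

Let UE i t : (\int[PS]_s (up i t s)%:E = (U i t)%:E)%E.
Proof. by rewrite fineK//; apply: integrable_fin_num => //; exact: integrable_up. Qed.

Let U0 i t : 0 <= U i t.
Proof. by rewrite -lee_fin -UE; apply: integral_ge0 => s _; rewrite lee_fin. Qed.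

(** Type [y] reporting [t i] pays what type [t i] pays; the difference to the truthful rent of the
    latter is linear in the values, and the payment is never integrated by itself. *)
Let misreport_utility i t (y : T i) : (expected_utility v g M y t tau =
  (U i t + \sum_th B i th t * (v (th i) y - v (th i) (t i)))%:E)%E.
Proof.
pose c th := v (th i) y - v (th i) (t i).
have ic1 th : PS.-integrable setT (fun s => (D th s * x i t s * c th)%:E).
  rewrite (_ : (fun s => _) = (fun s => (D th s * x i t s)%:E) \* cst (c th)%:E)%E//.
  by apply: integrableZr => //; exact: integrable_Dx.
have icx : PS.-integrable setT (fun s => (\sum_th D th s * x i t s * c th)%:E).
  rewrite (_ : (fun s => _) = (fun s => \sum_th (D th s * x i t s * c th)%:E)%E).
    exact: integrable_sum.
  by apply/funext => s; rewrite sumEFin.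
transitivity (\int[PS]_s ((up i t s)%:E + (\sum_th D th s * x i t s * c th)%:E))%E.
  apply: ae_eq_integral => //.
  - exact: measurable_utility.
  - by apply: emeasurable_funD; [exact: (measurable_int _ (integrable_up i t))|exact: (measurable_int _ icx)].
  apply: ae_imply revealed_ae => s us _; rewrite -EFinM -EFinD; congr EFin.
  rewrite /up max_r// uE /utility mulrBr mulrCA /post_value posterior_mean mulr_sumr.
  rewrite -/(p i t s) -/(x i t s) addrAC -big_split/=; congr (_ - _).
  by apply: eq_bigr => th _; rewrite /c; ring.
rewrite (integralD measurableT (integrable_up i t) icx).
rewrite UE EFinD; congr (_ + _)%E; under eq_integral do rewrite -sumEFin.
rewrite integral_sum//.
rewrite -sumEFin; apply: eq_bigr => th _; under eq_integral do rewrite EFinM.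
by rewrite integralZr ?BE//; exact: integrable_Dx.
Qed.

Let dfwith_id i (k : forall j, probability (dist R (Theta j)) R) :
  dfwith k i (k i) = k.
Proof.
apply: functional_extensionality_dep => j.
by have [<-|ij] := eqVneq i j; rewrite ?dfwithin// dfwithout.
Qed.

Let subgradient i t (b b' : T i) :
  \sum_th B i th (dfwith t i b) * (v (th i) b' - v (th i) b)
  <= U i (dfwith t i b') - U i (dfwith t i b).
Proof.
have := IIC (dfwith t i b') b (MPS_refl (tau i)); rewrite dfwithin dfwith_id.
rewrite (_ : dfwith (dfwith t i b') i b = dfwith t i b); last first.
  apply: functional_extensionality_dep => j.
  by have [<-|ij] := eqVneq i j; rewrite ?dfwithin// !dfwithout.
rewrite !misreport_utility lee_fin !dfwithin.
under [X in _ <= _ + X -> _]eq_bigr do rewrite subrr mulr0.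
by rewrite big1_eq addr0 lerBrDl.
Qed.

Let rent_ge i t : (\int[h i]_b (\sum_th B i th (dfwith t i b) *
    hazard_inv (v (th i) : {RV (h i) >-> R}) (f (th i)) b)%:E
  <= \int[h i]_b (U i (dfwith t i b))%:E)%E.
Proof.
have [iv itv fv vord] := vhf_myerson.
(* Values of bidder [i] depend on the own state only, so the weights of all state profiles with the
   same coordinate [i] are merged. *)
pose A (a : Theta i) b := \sum_(th : state_profile Theta | th i == a) B i th (dfwith t i b).
have AE (c : Theta i -> R) b :
    \sum_th B i th (dfwith t i b) * c (th i) = \sum_a A a b * c a.
  rewrite (partition_big (fun th : state_profile Theta => th i) predT)//=.
  by apply: eq_bigr => a _; rewrite mulr_suml; apply: eq_bigr => th /eqP ->.
under eq_integral do rewrite (AE (fun a => hazard_inv (v a : {RV (h i) >-> R}) (f a) _)).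
apply: (envelope_ge (point : Theta i)) => //.
- by move=> a; have [] := f_density a.
- by move=> a; have [] := f_density a.
- by move=> a; have [] := f_density a.
- by move=> a b; apply: sumr_ge0.
- move=> a; rewrite (_ : A a = fun b =>
      \sum_(th : state_profile Theta) if th i == a then B i th (dfwith t i b) else 0); last first.
    by apply/funext => b; rewrite /A big_mkcond.
  apply: measurable_sum => th; case: (th i == a) => //.
  exact: (measurableT_comp (mB i th) (@measurable_dfwith_own _ _ _ t i)).
- by move=> b b'; rewrite -(AE (fun a => v a b' - v a b)); exact: subgradient.
Qed.

Let mhaz i (a : Theta i) : measurable_fun setT (hazard_inv (v a : {RV (h i) >-> R}) (f a)).
Proof. by have [mf _ _] := f_density a; exact: measurable_hazard_inv. Qed.

Let haz0 i (a : Theta i) (y : T i) : 0 <= hazard_inv (v a : {RV (h i) >-> R}) (f a) y.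
Proof. by apply: hazard_inv_ge0; have [] := f_density a. Qed.

Let mrho i th : measurable_fun setT
  (fun z : signal_profile R Theta * profile T => rho z.2 th i).
Proof.
apply: (measurableT_comp (mhaz (th i))).
exact: (measurableT_comp (@measurable_coord _ _ _ i)).
Qed.

Let mDxrho i : measurable_fun setT (fun z : signal_profile R Theta * profile T =>
  \sum_th D th z.1 * x i z.2 z.1 * rho z.2 th i).
Proof.
by apply: measurable_sum => th; apply: measurable_funM => //; exact: measurable_funM.
Qed.

Let Dxrho0 i s t : 0 <= \sum_th D th s * x i t s * rho t th i.
Proof. by apply: sumr_ge0 => th _; rewrite mulr_ge0 ?haz0// mulr_ge0. Qed.

(** Integrating the signals out first, at fixed types, produces [B] and [U]; resampling the own type
    then brings in [rent_ge] for each profile of opponents. *)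
Lemma virtual_rent_le i :
  (\int[(PS \x PT)%E]_z (\sum_th D th z.1 * x i z.2 z.1 * rho z.2 th i)%:E
   <= \int[(PS \x PT)%E]_z (up i z.2 z.1)%:E)%E.
Proof.
rewrite fubini_tonelli2//; last 2 first.
- exact/measurable_EFinP.
- by move=> z; rewrite lee_fin.
rewrite [leRHS]fubini_tonelli2//; last 2 first.
- exact/measurable_EFinP.
- by move=> z; rewrite lee_fin.
rewrite /fubini_G/=.
have G1 t : (\int[PS]_s (\sum_th D th s * x i t s * rho t th i)%:E =
    (\sum_th B i th t * rho t th i)%:E)%E.
  under eq_integral do rewrite -sumEFin.
  rewrite ge0_integral_sum//; last 2 first.
  - move=> th; apply/measurable_EFinP; apply: measurable_funM => //.
    by have /measurable_int/measurable_EFinP := integrable_Dx i th t.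
  - by move=> th s _; rewrite lee_fin; apply: mulr_ge0; [exact: mulr_ge0|exact: haz0].
  rewrite -sumEFin; apply: eq_bigr => th _; under eq_integral do rewrite EFinM.
  by rewrite integralZr ?BE//; exact: integrable_Dx.
under eq_integral do rewrite G1.
under [leRHS]eq_integral do rewrite UE.
have mG : measurable_fun setT (fun t => (\sum_th B i th t * rho t th i)%:E).
  apply/measurable_EFinP; apply: measurable_sum => th; apply: measurable_funM => //.
  exact: (measurableT_comp (mhaz (th i)) (@measurable_coord _ _ _ i)).
have mU : measurable_fun setT (fun t => (U i t)%:E).
  apply/measurable_EFinP; apply: (measurableT_comp (f := fine)) => //.
  apply: (@measurable_fun_fubini_tonelli_G _ _ _ _ _ PS
    (fun z : signal_profile R Theta * profile T => (up i z.2 z.1)%:E)).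
    exact/measurable_EFinP.
  by move=> z; rewrite lee_fin.
have G0 t : (0 <= (\sum_th B i th t * rho t th i)%:E)%E.
  by rewrite lee_fin; apply: sumr_ge0 => th _; rewrite mulr_ge0 ?haz0.
rewrite (ge0_integral_resample h i)//.
rewrite [leRHS](ge0_integral_resample h i)//; last by move=> t; rewrite lee_fin.
apply: ge0_le_integral => //.
- by move=> t _; apply: integral_ge0.
- exact: (@measurable_integral_dfwith _ _ _ _ h i
    (fun t => (\sum_th B i th t * rho t th i)%:E) mG G0).
- apply: (@measurable_integral_dfwith _ _ _ _ h i (fun t => (U i t)%:E) mU) => t.
  by rewrite lee_fin.
move=> t _; under eq_integral do under eq_bigr do rewrite dfwithin.
exact: rent_ge.
Qed.

Let revealed_ae2 : {ae (PS \x PT)%E, forall z, forall i, 0 <= u i z.2 z.1}.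
Proof.
have [N [mN N0 NA]] := revealed_ae.
exists (N `*` setT); split.
- exact: measurableX.
- rewrite product_measure1E//; transitivity (0 * PT setT)%E; last exact: mul0e.
  by congr (_ * _)%E; exact: N0.
- move=> [s t] /= H; split => //; apply: NA => /= A; apply: H => i; exact: A.
Qed.

(** The rent is at most the expected absolute value. Its finiteness permits the cancellation in
    [revenue_le_virtual]. *)
Let rent_fin : (\int[(PS \x PT)%E]_z (\sum_i up i z.2 z.1)%:E < +oo)%E.
Proof.
have mabs th i : measurable_fun setT
    (fun z : signal_profile R Theta * profile T => `|v (th i) (z.2 i)|).
  exact: (measurableT_comp (@normr_measurable _ _) (mv i th)).
apply: (@le_lt_trans _ _ (\int[(PS \x PT)%E]_z
    (\sum_i \sum_th D th z.1 * `|v (th i) (z.2 i)|)%:E)%E).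
  apply: ge0_le_integral => //.
  - by move=> z _; rewrite lee_fin sumr_ge0.
  - by apply/measurable_EFinP; apply: measurable_sum.
  - apply/measurable_EFinP; apply: measurable_sum => i; apply: measurable_sum => th.
    exact: measurable_funM.
  - by move=> z _; rewrite lee_fin; apply: ler_sum.
under eq_integral do rewrite -sumEFin.
rewrite ge0_integral_sum//; last 2 first.
- move=> i; apply/measurable_EFinP; apply: measurable_sum => th.
  exact: measurable_funM.
- by move=> i z _; rewrite lee_fin sumr_ge0// => th _; rewrite mulr_ge0.
apply: lte_sum_pinfty => i _; under eq_integral do rewrite -sumEFin.
rewrite ge0_integral_sum//; last 2 first.
- by move=> th; apply/measurable_EFinP; exact: measurable_funM.
- by move=> th z _; rewrite lee_fin mulr_ge0.
apply: lte_sum_pinfty => th _.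
rewrite fubini_tonelli1//; last 2 first.
- by apply/measurable_EFinP; exact: measurable_funM.
- by move=> z; rewrite lee_fin mulr_ge0.
rewrite /fubini_F/=; set c := (\int[h i]_y `|(v (th i) y)%:E|)%E.
have coo : (c < +oo)%E by have [iv _ _ _] := vhf_myerson; case/integrableP: (iv i (th i)).
have c0 : (0 <= c)%E by exact: integral_ge0.
have E s : (\int[PT]_t (D th s * `|v (th i) (t i)|)%:E = (D th s)%:E * c)%E.
  under eq_integral do rewrite EFinM.
  have mabs' : measurable_fun setT (fun t : profile T => (`|v (th i) (t i)|)%:E).
    apply/measurable_EFinP; apply: (measurableT_comp (@normr_measurable _ _)).
    exact: (measurableT_comp (f := v (th i)) _ (@measurable_coord _ _ _ i)).
  rewrite ge0_integralZl ?lee_fin//; congr (_ * _)%E.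
  rewrite (ge0_integral_coord h (i := i) (G := fun y => (`|v (th i) y|)%:E))//.
  by apply/measurable_EFinP; exact: (measurableT_comp (@normr_measurable _ _)).
under eq_integral do rewrite E.
rewrite ge0_integralZr//.
- by rewrite integral_state_signal_density// lte_mul_pinfty// lee_fin dist_ge0.
- by apply/measurable_EFinP; exact: measurable_state_signal_density.
- by move=> s _; rewrite lee_fin.
Qed.

Lemma revenueE (M' : mechanism R T Theta) : is_mechanism M' ->
  revenue g tau h M' = (\int[PS]_s \int[PT]_t
    (signal_density g s * \sum_i pay M' t (posterior g s) i)%:E)%E.
Proof.
move=> mM'; rewrite /revenue /expect_signals; apply: eq_integral => s _.
have pay0 t : 0 <= \sum_i pay M' t (posterior g s) i.
  by apply: sumr_ge0 => i _; case: mM' => /(_ t (posterior g s) i)[].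
under [RHS]eq_integral do rewrite EFinM.
rewrite ge0_integralZl ?lee_fin ?signal_density_ge0//; last first.
  by move=> t _; rewrite lee_fin.
apply/measurable_EFinP; apply: measurable_sum => i.
have mt : measurable_fun setT (fun t : profile T => (s, t)) by exact: measurable_fun_pair.
exact: (measurableT_comp (measurable_pay_posterior g i mM') mt).
Qed.

Hypothesis reg_virtual : regular_virtual_values v h f.
Variable prio : {perm 'I_n}.
Local Notation phi := (virtual_value v h f).
Local Notation win := (wins v h f prio).

Let W (z : signal_profile R Theta * profile T) : R :=
  \sum_th D th z.1 * \sum_i (win z.2 th i)%:R * phi (z.2 i) (th i).

Let W0 z : 0 <= W z.
Proof.
apply: sumr_ge0 => th _; rewrite mulr_ge0//; apply: sumr_ge0 => i _.
exact: wins_virtual_ge0.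
Qed.

Let mW : measurable_fun setT W.
Proof.
apply: measurable_sum => th; apply: measurable_funM => //.
apply: measurable_sum => i.
exact: (measurableT_comp (measurable_wins_virtual prio f_density th i)).
Qed.

(** Payment plus rent is the surplus, and each value is its virtual value plus the inverse hazard
    rate. The additive form keeps every integrand nonnegative. *)
Let welfare_le (z : signal_profile R Theta * profile T) :
  (forall i, 0 <= u i z.2 z.1) ->
  \sum_i p i z.2 z.1 + \sum_i up i z.2 z.1
  <= W z + \sum_i \sum_th D th z.1 * x i z.2 z.1 * rho z.2 th i.
Proof.
case: z => s t /= us; rewrite -big_split/=.
rewrite (eq_bigr (fun i => \sum_th D th s * (x i t s * v (th i) (t i)))); last first.
  move=> i _; rewrite /up max_r// uE addrC subrK.
  by apply: eq_bigr => th _; rewrite mulrA.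
rewrite -lerBlDr -sumrB.
rewrite (eq_bigr (fun i => \sum_th D th s * (x i t s * phi (t i) (th i)))); last first.
  move=> i _; rewrite -sumrB; apply: eq_bigr => th _.
  by rewrite virtual_valueE; ring.
rewrite exchange_big/=; apply: ler_sum => th _; rewrite -mulr_sumr ler_wpM2l//.
exact: virtual_welfare_le.
Qed.

Let revenue_le_virtual :
  (revenue g tau h M <= \int[(PS \x PT)%E]_z (W z)%:E)%E.
Proof.
have mP : measurable_fun setT (fun z : signal_profile R Theta * profile T =>
    (\sum_i p i z.2 z.1)%:E).
  by apply/measurable_EFinP; exact: measurable_sum.
have mU : measurable_fun setT (fun z : signal_profile R Theta * profile T =>
    (\sum_i up i z.2 z.1)%:E).
  by apply/measurable_EFinP; exact: measurable_sum.
have mX : measurable_fun setT (fun z : signal_profile R Theta * profile T =>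
    (\sum_i \sum_th D th z.1 * x i z.2 z.1 * rho z.2 th i)%:E).
  by apply/measurable_EFinP; exact: measurable_sum.
have mW' : measurable_fun setT (fun z => (W z)%:E) by exact/measurable_EFinP.
have P0 (z : signal_profile R Theta * profile T) : (0 <= (\sum_i p i z.2 z.1)%:E)%E.
  by rewrite lee_fin; exact: sumr_ge0.
have U0' (z : signal_profile R Theta * profile T) : (0 <= (\sum_i up i z.2 z.1)%:E)%E.
  by rewrite lee_fin; exact: sumr_ge0.
have X0' (z : signal_profile R Theta * profile T) :
    (0 <= (\sum_i \sum_th D th z.1 * x i z.2 z.1 * rho z.2 th i)%:E)%E.
  by rewrite lee_fin; apply: sumr_ge0 => i _; exact: Dxrho0.
have W0' z : (0 <= (W z)%:E)%E by rewrite lee_fin.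
rewrite revenueE// [leLHS](_ : _ = \int[(PS \x PT)%E]_z (\sum_i p i z.2 z.1)%:E)%E; last first.
  rewrite fubini_tonelli1//; apply: eq_integral => s _.
  by apply: eq_integral => t _; rewrite mulr_sumr.
have fin : (\int[(PS \x PT)%E]_z (\sum_i up i z.2 z.1)%:E)%E \is a fin_num.
  by rewrite ge0_fin_numE ?rent_fin//; exact: integral_ge0.
rewrite -(leeD2rE _ _ fin) -ge0_integralD//.
apply: (@le_trans _ _ (\int[(PS \x PT)%E]_z ((W z)%:E +
    (\sum_i \sum_th D th z.1 * x i z.2 z.1 * rho z.2 th i)%:E))%E).
  apply: ae_ge0_le_integral => //.
  - by move=> z _; exact: adde_ge0.
  - exact: emeasurable_funD.
  - by move=> z _; exact: adde_ge0.
  - exact: emeasurable_funD.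
  - by apply: ae_imply revealed_ae2 => z uz _; rewrite -!EFinD lee_fin welfare_le.
rewrite ge0_integralD// leeD2l//.
under eq_integral do rewrite -sumEFin.
under [leRHS]eq_integral do rewrite -sumEFin.
rewrite ge0_integral_sum//; last 2 first.
- by move=> i; exact/measurable_EFinP.
- by move=> i z _; rewrite lee_fin.
rewrite [leRHS]ge0_integral_sum//; last 2 first.
- by move=> i; exact/measurable_EFinP.
- by move=> i z _; rewrite lee_fin.
by apply: lee_sum => i _; exact: virtual_rent_le.
Qed.

(** At each signal profile both sides are mixtures, with weights [D th s], of integrals over types
    at a fixed state, where [wins_virtual_revenue] applies. *)
Lemma revenue_le_SMA : (revenue g tau h M <= revenue g tau h (SMA v h f prio))%E.
Proof.
apply: (le_trans revenue_le_virtual).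
have mSMA : is_mechanism (SMA v h f prio) by exact: is_mechanism_SMA.
have mW' : measurable_fun setT (fun z => (W z)%:E) by exact/measurable_EFinP.
rewrite fubini_tonelli1//.
rewrite revenueE//.
have mpay th i : measurable_fun setT (fun t => myerson_pay v h f prio t th i).
  exact: measurable_myerson_pay.
have pay0 t th i : 0 <= myerson_pay v h f prio t th i by exact: myerson_pay_ge0.
have mpays : measurable_fun setT (fun z : signal_profile R Theta * profile T =>
    (signal_density g z.1 * \sum_i Defs.pay (SMA v h f prio) z.2 (posterior g z.1) i)%:E).
  apply/measurable_EFinP; apply: measurable_funM.
    exact: (measurableT_comp (measurable_signal_density g)).
  by apply: measurable_sum => i; exact: measurable_pay_posterior.
have pays0 (z : signal_profile R Theta * profile T) : (0 <=
    (signal_density g z.1 * \sum_i Defs.pay (SMA v h f prio) z.2 (posterior g z.1) i)%:E)%E.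
  rewrite lee_fin mulr_ge0 ?signal_density_ge0//; apply: sumr_ge0 => i _.
  by case: mSMA => /(_ z.2 (posterior g z.1) i)[].
apply: ge0_le_integral => //.
- by move=> s _; apply: integral_ge0 => t _; rewrite lee_fin.
- exact: measurable_fun_fubini_tonelli_F.
- exact: (@measurable_fun_fubini_tonelli_F _ _ _ _ _ PT _ mpays pays0).
move=> s _; rewrite /fubini_F/=.
rewrite [leRHS](_ : _ = \int[PT]_t (\sum_th D th s *
    \sum_i myerson_pay v h f prio t th i)%:E)%E; last first.
  apply: eq_integral => t _; rewrite exchange_big/= -posterior_mean.
  by congr (_ * _)%:E; apply: eq_bigr => th _; rewrite mulr_sumr.
under eq_integral do rewrite /W -sumEFin/=.
under [leRHS]eq_integral do rewrite -sumEFin.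
have mwv th i := measurable_wins_virtual prio f_density th i.
have wv0 t th i : 0 <= (win t th i)%:R * phi (t i) (th i) by exact: wins_virtual_ge0.
have split (q : profile T -> state_profile Theta -> 'I_n -> R) :
    (forall th i, measurable_fun setT (fun t => q t th i)) ->
    (forall t th i, 0 <= q t th i) ->
    (\int[PT]_t (\sum_th (D th s * \sum_i q t th i)%:E)
     = \sum_th (D th s)%:E * \sum_i \int[PT]_t (q t th i)%:E)%E.
  move=> mq q0; rewrite ge0_integral_sum//; last 2 first.
  - by move=> th; apply/measurable_EFinP; apply: measurable_funM => //; exact: measurable_sum.
  - by move=> th t _; rewrite lee_fin mulr_ge0// sumr_ge0.
  apply: eq_bigr => th _; under eq_integral do rewrite EFinM.
  rewrite ge0_integralZl ?lee_fin//; last 2 first.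
  - by apply/measurable_EFinP; exact: measurable_sum.
  - by move=> t _; rewrite lee_fin sumr_ge0.
  congr (_ * _)%E; under eq_integral do rewrite -sumEFin.
  rewrite ge0_integral_sum//.
  - by move=> i; exact/measurable_EFinP.
  - by move=> i t _; rewrite lee_fin.
rewrite (split (fun t th i => (win t th i)%:R * phi (t i) (th i)))// split//.
apply: lee_sum => th _; apply: lee_wpmul2l; rewrite ?lee_fin//.
apply: lee_sum => i _; exact: wins_virtual_revenue.
Qed.

End optimality.

Theorem proposition6p5 (R : realType) (n : nat) (d : 'I_n -> measure_display)
    (T : forall i, measurableType (d i)) (Theta : 'I_n -> pfinType)
    (v : forall i, Theta i -> {mfun T i >-> R})
    (g : dist R (state_profile Theta))
    (h : forall i, probability (T i) R)
    (tau : forall i, probability (dist R (Theta i)) R)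
    (f : forall i, Theta i -> R -> R)
    (prio : {perm 'I_n})
    (tau_experiment : forall i, is_experiment g (tau i))
    (tau_cond_independent : signals_cond_independent g tau)
    (f_density : is_value_density v h f)
    (vhf_myerson : myerson_setting v h f)
    (info_sufficient : information_sufficient v h f prio tau)
    (reg_values : regular_values v)
    (reg_virtual_values : regular_virtual_values v h f) :
  [/\ is_mechanism (SMA v h f prio),
      expost_IIC v g tau (SMA v h f prio),
      expost_IR v g tau (SMA v h f prio) &
      forall M : mechanism R T Theta,
        is_mechanism M -> expost_IIC v g tau M -> expost_IR v g tau M ->
        (revenue g tau h M <= revenue g tau h (SMA v h f prio))%E].
Proof.
split.
- exact: is_mechanism_SMA.
- exact: expost_IIC_SMA.
- exact: expost_IR_SMA.
- by move=> M mM IIC IR; exact: revenue_le_SMA.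
Qed.
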